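(* The $R[q^{\pm1}]$-module $\bigwedge^kV[q^{\pm1}]$ together with the $R[q^{\pm1}]$-bilinear operation determined by $$|w\rangle\star|u\rangle:=\mathfrak{S}_w(X_1^q,\ldots,X_k^q|y)\,|u\rangle,\qquad |u\rangle=v_{u_1}\wedge\cdots\wedge v_{u_k},$$ for Grassmannian permutations $u,w\in S^{k,n}$, is a well-defined commutative, associative, unital, graded ring which is isomorphic to $qH^*_T(\mathrm{Gr}(k;n))$. Moreover, the isomorphism is canonical: it maps the basis vectors $|w\rangle=v_{w_1}\wedge\cdots\wedge v_{w_k}$ of $\bigwedge^kV[q^{\pm1}]$ to the Schubert classes $\sigma_w$.
   Context: Fix $n\ge2$ and $1\le k\le n$. Let $R=\mathbb{Z}[y_1,\ldots,y_n]$, and $y_j:=0$ for $j>n$. $S^{k,n}\subset S_n$ is the set of Grassmannian permutations $w=[w_1\ldots w_n]$ (one-line notation), i.e. $w_1<\cdots<w_k$ and $w_{k+1}<\cdots<w_n$; they are in bijection with partitions $\lambda(w)=(\lambda_1,\ldots,\lambda_k)$ inside the $k\times(n-k)$ rectangle via $w_j=\lambda_{k+1-j}+j$. Put $(x|y)^m=\prod_{i=1}^m(x-y_i)$. The factorial Schur polynomial is $s_\lambda(x_1,\ldots,x_k|y)=\det\big((x_j|y)^{\lambda_i+k-i}\big)_{1\le i,j\le k}/\prod_{i<j}(x_i-x_j)$, and $h_r=s_{(r)}(x_1,\ldots,x_k|y)$. For $w\in S^{k,n}$ the double Schubert polynomial is $\mathfrak{S}_w(x_1,\ldots,x_k|y)=s_{\lambda(w)}(x_1,\ldots,x_k|y)$.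 The equivariant quantum cohomology ring is $$qH_T^*(\mathrm{Gr}(k;n))=R[q^{\pm1}][x_1,\ldots,x_k]^{S_k}/\langle h_{n-k+1},\ldots,h_{n-1},h_n+(-1)^kq\rangle ,$$ with basis over $R[q^{\pm1}]$ given by the Schubert classes $\sigma_w$ = class of $s_{\lambda(w)}(x_1,\ldots,x_k|y)$, $w\in S^{k,n}$. $V=R^n$ with standard basis $v_1,\ldots,v_n$, and $V^{\otimes k}[q^{\pm1}]$, $\bigwedge^kV[q^{\pm1}]$ denote extension of scalars to $R[q^{\pm1}]$. The quantised Chern root is the $n\times n$ matrix $$X^q=(-1)^{k-1}q\,E_{1,n}+\sum_{i=1}^{n-1}E_{i+1,i}+\sum_{i=1}^ny_iE_{ii},$$ ($E_{ij}$ the matrix units, $E_{ij}v_j=v_i$), satisfying $\prod_{j=1}^n(X^q-y_j)=(-1)^{k-1}q$. $X_i^q$ acts on $V^{\otimes k}[q^{\pm1}]$ as $X^q$ in the $i$-th tensor factor and as the identity in the others. Symmetric polynomials in the commuting operators $X^q_1,\ldots,X^q_k$ commute with the canonical projection $V^{\otimes k}[q^{\pm1}]\to\bigwedge^kV[q^{\pm1}]$ and hence act on $\bigwedge^kV[q^{\pm1}]$. Grading: $\deg y_i=1$, $\deg q=n$, $\deg|w\rangle=|\lambda(w)|$. *)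

(* Defs.v *)
From HB Require Import structures.
From mathcomp Require Import all_boot all_order all_algebra perm.
From mathcomp Require Import boolp.
From mathcomp Require Import mpoly ring.

Set Implicit Arguments.
Unset Strict Implicit.
Unset Printing Implicit Defensive.

Import GRing.Theory.
Local Open Scope ring_scope.
Local Open Scope quotient_scope.

Section LinearSpan.
Variables (K : comNzRingType) (M : lmodType K).

Definition span (G : M -> Prop) : pred M := fun x =>
  `[< exists (r : nat) (c : 'I_r -> K) (g : 'I_r -> M),
        (forall i, G (g i)) /\ x = \sum_i c i *: g i >].

Variable G : M -> Prop.

Lemma spanP x : reflect
  (exists (r : nat) (c : 'I_r -> K) (g : 'I_r -> M),
     (forall i, G (g i)) /\ x = \sum_i c i *: g i) (x \in span G).
Proof. exact: asboolP. Qed.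

Lemma span0 : 0 \in span G.
Proof.
apply/spanP; exists 0, (fun=> 0), (fun=> 0); split; first by case.
by rewrite big_ord0.
Qed.

Lemma spanD x y : x \in span G -> y \in span G -> x + y \in span G.
Proof.
case/spanP=> [r [c [g [Gg ->]]]] /spanP [r' [c' [g' [Gg' ->]]]].
apply/spanP; exists (r + r')%N.
exists (fun i => match split i with inl a => c a | inr b => c' b end).
exists (fun i => match split i with inl a => g a | inr b => g' b end).
split; first by move=> i; case: (split i).
rewrite big_split_ord /=; congr (_ + _); apply: eq_bigr => i _.
  by rewrite (unsplitK (inl _ i)).
by rewrite (unsplitK (inr _ i)).
Qed.

Lemma spanZ a x : x \in span G -> a *: x \in span G.
Proof.
case/spanP=> [r [c [g [Gg ->]]]].
apply/spanP; exists r, (fun i => a * c i), g; split=> //.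
by rewrite scaler_sumr; apply: eq_bigr => i _; rewrite scalerA.
Qed.

Lemma mem_span x : G x -> x \in span G.
Proof.
move=> Gx; apply/spanP; exists 1, (fun=> 1), (fun=> x); split=> //.
by rewrite big_ord1 scale1r.
Qed.

Fact span_zmod_closed : zmod_closed (span G).
Proof.
split=> [|x y Sx Sy]; first exact: span0.
by apply: spanD => //; rewrite -scaleN1r; exact: spanZ.
Qed.

HB.instance Definition _ :=
  GRing.isZmodClosed.Build M (span G) span_zmod_closed.

End LinearSpan.

Section QuotientModule.
Variables (K : comNzRingType) (M : lmodType K) (G : M -> Prop).

Definition span_zmod : zmodClosed M := GRing.ZmodClosed.clone M (span G) _.

Definition quot_mod : Type := Quotient.quot span_zmod.

HB.instance Definition _ := GRing.Zmodule.on quot_mod.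
HB.instance Definition _ := Quotient.on quot_mod.

Definition qpi (x : M) : quot_mod := \pi_(Quotient.quot span_zmod) x.

Lemma qpi_eq x y : (qpi x = qpi y) <-> (x - y \in span G).
Proof. by rewrite Quotient.idealrBE; split=> /eqP. Qed.

Lemma qpiK (x : quot_mod) : qpi (repr x) = x.
Proof. exact: reprK. Qed.

Lemma qpiB x y : qpi (x - y) = qpi x - qpi y.
Proof. exact: raddfB. Qed.

Lemma qpiD x y : qpi (x + y) = qpi x + qpi y.
Proof. exact: raddfD. Qed.

Definition quot_scale (a : K) (x : quot_mod) : quot_mod := qpi (a *: repr x).

Lemma qpi_scale a x : qpi (a *: x) = quot_scale a (qpi x).
Proof.
by apply/qpi_eq; rewrite -scalerBr spanZ //; apply/qpi_eq; rewrite qpiK.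
Qed.

Fact quot_scaleA a b x : quot_scale a (quot_scale b x) = quot_scale (a * b) x.
Proof. by rewrite -[x]qpiK -!qpi_scale scalerA. Qed.
Fact quot_scale1 : left_id 1 quot_scale.
Proof. by move=> x; rewrite -[x]qpiK -!qpi_scale scale1r. Qed.
Fact quot_scaleDr : right_distributive quot_scale +%R.
Proof.
by move=> a x y; rewrite -[x]qpiK -[y]qpiK -qpiD -!qpi_scale -qpiD scalerDr.
Qed.
Fact quot_scaleDl x : {morph quot_scale^~ x : a b / a + b}.
Proof. by move=> a b; rewrite -[x]qpiK -!qpi_scale -qpiD scalerDl. Qed.

HB.instance Definition _ := GRing.Zmodule_isLmodule.Build K quot_mod
  quot_scaleA quot_scale1 quot_scaleDr quot_scaleDl.

Fact qpi_is_linear : linear qpi.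
Proof. by move=> a x y; rewrite qpiD qpi_scale. Qed.

HB.instance Definition _ := GRing.isLinear.Build K M quot_mod *:%R qpi
  qpi_is_linear.

End QuotientModule.

(* Quotient of a commutative algebra by the ideal generated by [gens]. It is  *)
(* not assumed (nor proved here) that the ideal is proper, whence pzRing.     *)
Section QuotientAlgebra.
Variables (K : comNzRingType) (A : comAlgType K) (gens : A -> Prop).

Definition multiple_of_gen (x : A) : Prop := exists a g, gens g /\ x = a * g.

Definition quot_alg : Type := quot_mod multiple_of_gen.

HB.instance Definition _ := GRing.Lmodule.on quot_alg.

Definition apr (x : A) : quot_alg := qpi multiple_of_gen x.

Lemma ideal_mull a x :
  x \in span multiple_of_gen -> a * x \in span multiple_of_gen.
Proof.
case/spanP=> [r [c [g [Gg ->]]]].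
apply/spanP; exists r, c, (fun i => a * g i); split=> [i|].
  by have [b [h [hh ->]]] := Gg i; exists (a * b), h; rewrite mulrA.
by rewrite mulr_sumr; apply: eq_bigr => i _; rewrite scalerAr.
Qed.

Definition quot_one : quot_alg := apr 1.
Definition quot_mul (x y : quot_alg) : quot_alg := apr (repr x * repr y).

Lemma apr_mul x y : apr (x * y) = quot_mul (apr x) (apr y).
Proof.
apply/qpi_eq; set x' := repr _; set y' := repr _.
have -> : x * y - x' * y' = y * (x - x') + x' * (y - y').
  by rewrite !mulrBr [y * x]mulrC [y * x']mulrC addrA subrK.
by apply: spanD; apply: ideal_mull; apply/qpi_eq; rewrite qpiK.
Qed.

Lemma aprK (x : quot_alg) : apr (repr x) = x.
Proof. exact: qpiK. Qed.

Lemma aprD x y : apr (x + y) = apr x + apr y.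
Proof. exact: qpiD. Qed.

Fact quot_mulA : associative quot_mul.
Proof. by move=> x y z; rewrite -[x]aprK -[y]aprK -[z]aprK -!apr_mul mulrA. Qed.
Fact quot_mulC : commutative quot_mul.
Proof. by move=> x y; rewrite -[x]aprK -[y]aprK -!apr_mul mulrC. Qed.
Fact quot_mul1 : left_id quot_one quot_mul.
Proof. by move=> x; rewrite -[x]aprK -!apr_mul mul1r. Qed.
Fact quot_mulDl : left_distributive quot_mul +%R.
Proof.
move=> x y z; rewrite -[x]aprK -[y]aprK -[z]aprK.
by rewrite -!(aprD, apr_mul) mulrDl.
Qed.

HB.instance Definition _ := GRing.Zmodule_isComPzRing.Build quot_alg
  quot_mulA quot_mulC quot_mul1 quot_mulDl.

Lemma aprZ a x : apr (a *: x) = a *: apr x.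
Proof. exact: qpi_scale. Qed.

Lemma aprM x y : apr (x * y) = apr x * apr y.
Proof. exact: apr_mul. Qed.

Lemma quot_scaleAl (a : K) (x y : quot_alg) : a *: (x * y) = (a *: x) * y.
Proof. by rewrite -[x]aprK -[y]aprK -aprM -!aprZ -aprM scalerAl. Qed.

End QuotientAlgebra.

Section SymmetricPolynomials.
Variables (K : comNzRingType) (k : nat).

Record sympoly : predArgType :=
  MkSympoly { sympoly_val :> {mpoly K[k]}; _ : symmetric_pred sympoly_val }.

HB.instance Definition _ := [isSub for sympoly_val].
HB.instance Definition _ := [Choice of sympoly by <:].
HB.instance Definition _ := [SubChoice_isSubComNzRing of sympoly by <:].
HB.instance Definition _ := [SubZmodule_isSubLmodule of sympoly by <:].
HB.instance Definition _ := [SubNzRing_SubLmodule_isSubLalgebra of sympoly by <:].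
HB.instance Definition _ := [SubLalgebra_isSubAlgebra of sympoly by <:].

Lemma sympolyP (p : sympoly) : (p : {mpoly K[k]}) \is symmetric.
Proof. exact: (valP p). Qed.

End SymmetricPolynomials.

Section VandermondeDivides.
Variable A : comNzRingType.

Lemma vandermonde_dvd k (x : 'I_k -> A) (f : 'I_k -> {poly A}) :
  exists s, s * \prod_(i < k) \prod_(j < k | (i < j)%N) (x i - x j)
            = \det (\matrix_(i, j) (f i).[x j]).
Proof.
elim: k => [|k IHk] in x f *.
  by exists 1; rewrite big_ord0 det_mx00 mulr1.
set x0 := x ord0.
have /choice [g gE] (i : 'I_k.+1) :
    exists q, f i - (f i).[x0]%:P = q * ('X - x0%:P).
  by apply/factor_theorem; rewrite /root !hornerE subrr.
have fE i z : (f i).[z] = (f i).[x0] + (g i).[z] * (z - x0).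
  have /(congr1 (fun p => p.[z])) := gE i.
  by rewrite !hornerE => <-; rewrite addrC subrK.
pose N : 'M[A]_k.+1 :=
  \matrix_(i, j) (if j == ord0 then (f i).[x0] else (g i).[x j]).
pose U : 'M[A]_k.+1 :=
  \matrix_(i, j) (if i == ord0 then 1 else if i == j then x j - x0 else 0).
have -> : \matrix_(i, j) (f i).[x j] = N *m U.
  apply/matrixP=> i j; rewrite !mxE big_ord_recl !mxE eqxx mulr1.
  case: (unliftP ord0 j) => [j'|] ->.
    rewrite (bigD1 j') //= big1 => [|l nlj].
      by rewrite !mxE /= eqxx addr0 fE.
    by rewrite !mxE /= (inj_eq lift_inj) (negbTE nlj) mulr0.
  by rewrite big1 ?addr0 // => l _; rewrite !mxE /= mulr0.
have detU : \det U = \prod_(j < k) (x (lift ord0 j) - x0).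
  rewrite -det_tr det_trig => [|]; last first.
    apply/is_trig_mxP => i j ltij; rewrite !mxE.
    have -> : (j == ord0) = false by apply/negbTE; rewrite -val_eqE /=; case: (val j) ltij.
    by rewrite -val_eqE /= gtn_eqF.
  by rewrite big_ord_recl !mxE eqxx mul1r; apply: eq_bigr => j _; rewrite !mxE /= eqxx.
have /choice [s sE] (i : 'I_k.+1) := IHk (x \o lift ord0) (g \o lift i).
exists ((-1) ^+ k * \sum_i (f i).[x0] * ((-1) ^+ (i + 0) * s i)).
rewrite det_mulmx detU (expand_det_col _ ord0).
set V := \prod_(i < k) \prod_(j < k | (i < j)%N)
  (x (lift ord0 i) - x (lift ord0 j)).
set D := \prod_(j < k) (x0 - x (lift ord0 j)).
have -> : \prod_(j < k) (x (lift ord0 j) - x0) = (-1) ^+ k * D.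
  by under eq_bigr do rewrite -opprB; rewrite prodrN /= card_ord.
have -> : \prod_(i < k.+1) \prod_(j < k.+1 | (i < j)%N) (x i - x j) = D * V.
  rewrite big_ord_recl; congr (_ * _).
    by rewrite big_mkcond big_ord_recl /= mul1r.
  apply: eq_bigr => i _.
  rewrite big_mkcond big_ord_recl /= mul1r [RHS]big_mkcond.
  by apply: eq_bigr => j _; rewrite /= /bump !add1n.
have -> : \sum_i N i ord0 * cofactor N i ord0
    = (\sum_i (f i).[x0] * ((-1) ^+ (i + 0) * s i)) * V.
  rewrite mulr_suml; apply: eq_bigr => i _.
  rewrite mxE eqxx -!mulrA; congr (_ * _); rewrite /cofactor; congr (_ * _).
  by rewrite sE; congr (\det _); apply/matrixP => a b; rewrite !mxE /=.
by rewrite -!mulrA mulrCA; congr (_ * _); rewrite [RHS]mulrCA [V * D]mulrC.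
Qed.

End VandermondeDivides.

Section FactorialSchur.
Variables (K : idomainType) (k : nat) (y : nat -> K).

Definition fact_power (B : lalgType K) (x : B) (m : nat) : B :=
  \prod_(l < m) (x - (y l)%:A).

(* The numerator and denominator of the factorial Schur polynomial; indices   *)
(* and the y_l are numbered from 0, so k - i becomes k - i.+1.                *)
Definition fschur_num (lam : 'I_k -> nat) : {mpoly K[k]} :=
  \det (\matrix_(i < k, j < k)
          fact_power ('X_j : {mpoly K[k]}) (lam i + (k - i.+1))).

Definition fschur_den : {mpoly K[k]} :=
  \prod_(i < k) \prod_(j < k | (i < j)%N) ('X_i - 'X_j).

Fact fschur_exists lam : exists s, s * fschur_den == fschur_num lam.
Proof.
pose f (i : 'I_k) : {poly {mpoly K[k]}} :=
  \prod_(l < lam i + (k - i.+1)) ('X - ((y l)%:A)%:P).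
have [s sE] := vandermonde_dvd (fun i : 'I_k => 'X_i : {mpoly K[k]}) f.
exists s; rewrite /fschur_den sE; apply/eqP; congr (\det _).
apply/matrixP=> i j; rewrite !mxE horner_prod; apply: eq_bigr => l _.
by rewrite !hornerE.
Qed.

(* The quotient is unique because [fschur_den] is not a zero divisor.         *)
Definition fschur_poly (lam : 'I_k -> nat) : {mpoly K[k]} :=
  xchoose (fschur_exists lam).

Lemma fschurE lam : fschur_poly lam * fschur_den = fschur_num lam.
Proof. exact/eqP/(xchooseP (fschur_exists lam)). Qed.

Lemma fschur_den_neq0 : fschur_den != 0.
Proof.
rewrite /fschur_den; apply/prodf_neq0 => i _; apply/prodf_neq0 => j ltij; rewrite subr_eq0.
apply/eqP => /mpolyP /(_ U_(i)%MM) /eqP.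
rewrite !mcoeffX eqxx eq_mnm1.
have -> : (j == i) = false by rewrite -val_eqE /= gtn_eqF.
by rewrite oner_eq0.
Qed.

Lemma msym_fact_power s (j : 'I_k) m :
  msym s (fact_power ('X_j : {mpoly K[k]}) m) = fact_power 'X_(s j) m.
Proof.
rewrite rmorph_prod; apply: eq_bigr => l _.
by rewrite rmorphB /= msymZ rmorph1 /msym mmapX mmap1U.
Qed.

Lemma msym_fschur_num s lam :
  msym s (fschur_num lam) = (-1) ^+ s * fschur_num lam.
Proof.
rewrite -det_map_mx [X in \det X](_ : _ = col_perm s (\matrix_(i, j)
  fact_power ('X_j : {mpoly K[k]}) (lam i + (k - i.+1)))); last first.
  by apply/matrixP => i j; rewrite !mxE; exact: msym_fact_power.
by rewrite col_permE det_mulmx det_perm odd_permV mulrC.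
Qed.

Lemma msym_fschur_den s : msym s fschur_den = (-1) ^+ s * fschur_den.
Proof.
pose a := \row_j (- ('X_j : {mpoly K[k]})).
have -> : fschur_den = \det (Vandermonde k a).
  rewrite det_Vandermonde; apply: eq_bigr => i _; apply: eq_bigr => j _.
  by rewrite !mxE opprK addrC.
rewrite -det_map_mx [X in \det X](_ : _ = col_perm s (Vandermonde k a)).
  by rewrite col_permE det_mulmx det_perm odd_permV mulrC.
apply/matrixP => i j; rewrite !mxE rmorphXn rmorphN /= .
by rewrite /msym mmapX mmap1U.
Qed.

Fact fschur_sym lam : fschur_poly lam \is symmetric.
Proof.
apply/issymP => s; apply: (mulIf fschur_den_neq0).
apply: (@mulfI _ ((-1) ^+ s)); first by rewrite signr_eq0.
rewrite mulrCA -msym_fschur_den -msymM fschurE msym_fschur_num.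
by rewrite -fschurE mulrCA.
Qed.

Definition fschur (lam : 'I_k -> nat) : sympoly K k :=
  MkSympoly (fschur_sym lam).

(* h_r = s_(r) *)
Definition fschur_row (r : nat) : sympoly K k :=
  fschur (fun i => if i == 0 :> nat then r else 0).

End FactorialSchur.

(* D[q, q^-1] as the subring of the fraction field of D[q] consisting of the  *)
(* fractions that some power of q brings into D[q].                           *)
Section Laurent.
Variable D : idomainType.

Definition is_laurent : pred {fraction {poly D}} := fun f =>
  `[< exists (N : nat) (p : {poly D}), f * (tofrac 'X) ^+ N = tofrac p >].

Fact is_laurent_subring : subring_closed is_laurent.
Proof.
split=> [|f g /asboolP[N [p fE]] /asboolP[M [r gE]]|f g /asboolP[N [p fE]]
  /asboolP[M [r gE]]]; apply/asboolP.
- by exists 0, 1; rewrite mulr1 rmorph1.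
- exists (N + M)%N, (p * 'X^M - r * 'X^N).
  rewrite rmorphB !rmorphM !rmorphXn /= -fE -gE exprD mulrBl !mulrA.
  by rewrite [g * _ * _]mulrAC.
- exists (N + M)%N, (p * r).
  by rewrite rmorphM /= -fE -gE exprD mulrACA.
Qed.

Record laurent : predArgType :=
  MkLaurent { laurent_val : {fraction {poly D}}; _ : is_laurent laurent_val }.

HB.instance Definition _ := [isSub for laurent_val].
HB.instance Definition _ := [Choice of laurent by <:].
HB.instance Definition _ := GRing.isSubringClosed.Build _ is_laurent
  is_laurent_subring.
HB.instance Definition _ := [SubChoice_isSubComNzRing of laurent by <:].

Definition laurent_unit : pred laurent := fun x => `[< exists z, z * x = 1 >].

Definition laurent_inv (x : laurent) : laurent :=
  if pselect (exists z, z * x = 1) is left e then projT1 (cid e) else x.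

Fact laurent_mulVx : {in laurent_unit, left_inverse 1 laurent_inv *%R}.
Proof.
move=> x /asboolP ex; rewrite /laurent_inv; case: pselect => // e.
exact: (projT2 (cid e)).
Qed.

Fact laurent_unitP (x z : laurent) : z * x = 1 -> laurent_unit x.
Proof. by move=> zx; apply/asboolP; exists z. Qed.

Fact laurent_inv_out : {in [predC laurent_unit], laurent_inv =1 id}.
Proof.
move=> x; rewrite inE /= => /asboolP nx.
by rewrite /laurent_inv; case: pselect.
Qed.

HB.instance Definition _ := GRing.ComNzRing_hasMulInverse.Build laurent
  laurent_mulVx laurent_unitP laurent_inv_out.

Fact laurent_idomain : GRing.integral_domain_axiom laurent.
Proof.
move=> x z /(congr1 val) /eqP; rewrite rmorphM rmorph0 mulf_eq0.
by rewrite -(rmorph0 (val : laurent -> _)) !(inj_eq val_inj).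
Qed.

HB.instance Definition _ := GRing.ComUnitRing_isIntegral.Build laurent
  laurent_idomain.

Fact is_laurent_poly (p : {poly D}) : is_laurent (tofrac p).
Proof. by apply/asboolP; exists 0, p; rewrite expr0 mulr1. Qed.

Definition poly_laurent (p : {poly D}) : laurent := MkLaurent (is_laurent_poly p).

End Laurent.

Section TensorPower.
Variables (K : comNzRingType) (n k : nat).

(* The k-th tensor power of V = K^n (column vectors): coordinates indexed by  *)
(* the words e_{w 0} (x) ... (x) e_{w (k-1)}.                                 *)
Definition tensor_power : Type := {ffun {ffun 'I_k -> 'I_n} -> K^o}.

HB.instance Definition _ := GRing.Lmodule.on tensor_power.

Definition tens (v : 'I_k -> 'cV[K]_n) : tensor_power :=
  [ffun w : {ffun 'I_k -> 'I_n} => \prod_i v i (w i) 0].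

Definition alternating_relator (t : tensor_power) : Prop :=
  exists v : 'I_k -> 'cV[K]_n,
    (exists i j, i != j /\ v i = v j) /\ t = tens v.

Definition ext_power : Type := quot_mod alternating_relator.

HB.instance Definition _ := GRing.Lmodule.on ext_power.

Definition ext_pi (t : tensor_power) : ext_power := qpi alternating_relator t.

Definition wedge (v : 'I_k -> 'cV[K]_n) : ext_power := ext_pi (tens v).

Variable X : 'M[K]_n.

Definition subst_letter (w : {ffun 'I_k -> 'I_n}) i j : {ffun 'I_k -> 'I_n} :=
  [ffun l => if l == i then j else w l].

(* X acting on the i-th tensor factor, cf. [factor_op_tens]. *)
Definition factor_op (i : 'I_k) (t : tensor_power) : tensor_power :=
  [ffun w : {ffun 'I_k -> 'I_n} => \sum_j X (w i) j * t (subst_letter w i j)].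

Definition monomial_op (m : 'X_{1..k}) (t : tensor_power) : tensor_power :=
  foldr (fun i => iter (m i) (factor_op i)) t (enum 'I_k).

Definition poly_op (p : {mpoly K[k]}) (t : tensor_power) : tensor_power :=
  \sum_(m <- msupp p) p@_m *: monomial_op m t.

Lemma factor_op_tens i v :
  factor_op i (tens v) = tens (fun l => if l == i then X *m v l else v l).
Proof.
apply/ffunP => w; rewrite !ffunE (bigD1 i) //= eqxx mxE mulr_suml.
apply: eq_bigr => j _; rewrite ffunE (bigD1 i) //= ffunE eqxx mulrA.
congr (_ * _); apply: eq_bigr => l nli.
by rewrite ffunE (negbTE nli).
Qed.

Lemma iter_factor_op_tens i v r : iter r (factor_op i) (tens v) =
  tens (fun l => if l == i then iter r (mulmx X) (v l) else v l).
Proof.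
elim: r => [|r /= ->] /=.
  by congr tens; apply/funext => l; case: ifP.
by rewrite factor_op_tens; congr tens; apply/funext => l; case: (l == i).
Qed.

Lemma monomial_op_tens m v :
  monomial_op m (tens v) = tens (fun i => iter (m i) (mulmx X) (v i)).
Proof.
rewrite /monomial_op.
have := enum_uniq 'I_k; set s := enum _.
have -> : (fun i => iter (m i) (mulmx X) (v i)) =
  (fun i => if i \in s then iter (m i) (mulmx X) (v i) else v i).
  by apply/funext => i; rewrite mem_enum.
elim: s => [_|i s IHs /= /andP[nis us]] //=.
rewrite IHs // iter_factor_op_tens; congr tens; apply/funext => l.
by rewrite inE; case: eqP => [->|//]; rewrite (negbTE nis).
Qed.

Fact factor_op_is_linear i : linear (factor_op i).
Proof.
move=> a t u; apply/ffunP => w; rewrite !ffunE scaler_sumr -big_split /=.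
apply: eq_bigr => j _; rewrite !ffunE mulrDr; congr (_ + _).
by rewrite mulrCA.
Qed.

Fact monomial_op_is_linear m : linear (monomial_op m).
Proof.
move=> a t u; rewrite /monomial_op; elim: (enum _) => //= i s ->.
by elim: (m i) => //= r ->; rewrite factor_op_is_linear.
Qed.

Fact poly_op_is_linear p : linear (poly_op p).
Proof.
move=> a t u; rewrite /poly_op scaler_sumr -big_split /=; apply: eq_bigr => m _.
by rewrite monomial_op_is_linear scalerDr !scalerA mulrC.
Qed.

HB.instance Definition _ p := GRing.isLinear.Build K tensor_power tensor_power
  *:%R (poly_op p) (poly_op_is_linear p).

Lemma tens_swap_span (v : 'I_k -> 'cV[K]_n) i j a b : i != j ->
    tens (fun l => if l == i then a else if l == j then b else v l)
  + tens (fun l => if l == i then b else if l == j then a else v l)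
    \in span alternating_relator.
Proof.
move=> nij.
pose put x z := tens (fun l => if l == i then x else if l == j then z else v l).
rewrite -/(put a b) -/(put b a).
have putE x z (w : {ffun 'I_k -> 'I_n}) : put x z w = x (w i) 0 * (z (w j) 0 *
    \prod_(l | (l != i) && (l != j)) v l (w l) 0).
  rewrite ffunE (bigD1 i) //= eqxx (bigD1 j) /=; last by rewrite eq_sym.
  rewrite eqxx eq_sym (negbTE nij); congr (_ * (_ * _)).
  by apply: eq_bigr => l /andP[/negbTE -> /negbTE ->].
have rel x : put x x \in span alternating_relator.
  apply: mem_span; eexists; split; last by [].
  by exists i, j; split=> //; rewrite eqxx [j == i]eq_sym (negbTE nij) eqxx.
have -> : put a b + put b a =
    put (a + b) (a + b) + ((-1) *: put a a + (-1) *: put b b).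
  apply/ffunP => w.
  have ffD (t u : tensor_power) : (t + u) w = t w + u w by rewrite ffunE.
  have ffZ c (t : tensor_power) : (c *: t) w = c * t w by rewrite ffunE.
  by rewrite !(ffD, ffZ) !putE !mxE; ring.
apply: spanD; first exact: rel.
by apply: spanD; apply: spanZ; exact: rel.
Qed.

Lemma poly_op_span p t : p \is symmetric ->
  t \in span alternating_relator -> poly_op p t \in span alternating_relator.
Proof.
move=> symp /spanP[r [c [g [Gg ->]]]]; rewrite linear_sum /=.
elim/big_ind: _ => [|x z|l _]; [exact: span0|exact: spanD|].
rewrite linearZ /=; apply: spanZ.
have [v [[i [j [nij vij]]] ->]] := Gg l.
pose T (m : 'X_{1..k}) :=
  p@_m *: tens (fun i => iter (m i) (mulmx X) (v i)).
have -> : poly_op p (tens v) = \sum_(m <- msupp p) T m.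
  by apply: eq_bigr => m _; rewrite monomial_op_tens.
rewrite (bigID (fun m : 'X_{1..k} => m i == m j)) /=; apply: spanD.
  elim/big_ind: _ => [|x z|m /eqP mij]; [exact: span0|exact: spanD|].
  apply: spanZ; apply: mem_span; eexists; split; last by [].
  by exists i, j; rewrite mij vij.
rewrite (bigID (fun m : 'X_{1..k} => m i < m j)%N) /=.
pose s := tperm i j; pose swap (m : 'X_{1..k}) := [multinom m (s l) | l < k].
have swapE m a : swap m a = m (s a) by rewrite mnmE.
have ssupp : perm_eq (msupp p) [seq (swap m) | m <- msupp p].
  apply: uniq_perm => //.
    rewrite map_inj_uniq // => m m' /mnmP mm'; apply/mnmP => a.
    by have := mm' (s a); rewrite !swapE tpermK.
  have key m : m \in msupp p -> (swap m) \in msupp p.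
    by rewrite issym_msupp.
  move=> m; apply/idP/mapP => [mp|[m' mp ->]]; last exact: key.
  exists (swap m); first exact: key.
  by apply/mnmP => a; rewrite !swapE tpermK.
have -> : \sum_(m <- msupp p | (m i != m j) && ~~ (m i < m j)%N) T m =
    \sum_(m <- msupp p | (m i != m j) && (m i < m j)%N) T (swap m).
  rewrite (perm_big _ ssupp) [LHS](big_map swap); apply: eq_bigl => m.
  by rewrite !swapE tpermL tpermR -leqNgt eq_sym; case: ltngtP.
rewrite -big_split /=.
elim/big_ind: _ => [|x z|m _]; [exact: span0|exact: spanD|].
rewrite /T (msym_coeff _ _ symp) -scalerDr; apply: spanZ.
apply: etrans (congr1 (fun x => x \in span alternating_relator) _)
  (@tens_swap_span (fun l => iter (m l) (mulmx X) (v l)) i j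
  (iter (m i) (mulmx X) (v i)) (iter (m j) (mulmx X) (v i)) nij).
congr (_ + _); congr tens; apply/funext => a.
  by case: eqP => [->//|_]; case: eqP => [->|//]; rewrite vij.
rewrite swapE; case: eqP => [->|/eqP nai]; first by rewrite tpermL.
case: eqP => [->|/eqP naj]; first by rewrite tpermR vij.
by rewrite tpermD // eq_sym.
Qed.

(* The action of symmetric polynomials on the exterior power; the choice of   *)
(* representative is irrelevant by [sym_op_pi].                               *)
Definition sym_op (p : sympoly K k) (x : ext_power) : ext_power :=
  ext_pi (poly_op p (repr x)).

Lemma sym_op_pi (p : sympoly K k) t :
  sym_op p (ext_pi t) = ext_pi (poly_op p t).
Proof.
apply/qpi_eq; rewrite -linearB; apply: poly_op_span (sympolyP p) _.
by apply/qpi_eq; rewrite qpiK.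
Qed.

End TensorPower.

Section GrassmannianPermutations.
Variables n k : nat.
Hypothesis lekn : (k <= n)%N.

Definition is_grassmannian (w : 'S_n) : bool :=
  [forall i : 'I_n, forall j : 'I_n,
     (i < j)%N && ((j < k) || (k <= i))%N ==> (w i < w j)%N].

Definition grass : predArgType := {w : 'S_n | is_grassmannian w}.

HB.instance Definition _ := Finite.on grass.

(* The letters w_1, ..., w_k, numbered from 0. *)
Definition letter (w : grass) (j : 'I_k) : 'I_n := val w (widen_ord lekn j).

(* w_j = lambda_{k+1-j} + j, where w_j and j are both shifted by one. *)
Definition grass_part (w : grass) (i : 'I_k) : nat :=
  letter w (rev_ord i) - rev_ord i.

Definition grass_size (w : grass) : nat := \sum_i grass_part w i.

End GrassmannianPermutations.

Section EquivariantQuantumCohomology.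
Variables n k : nat.

Definition ybase : idomainType := {mpoly int[n]}.

Definition qbase : idomainType := laurent ybase.

Definition qvar : qbase := poly_laurent 'X.

(* y_(l+1), which is 0 if l >= n *)
Definition yvar (l : nat) : qbase :=
  poly_laurent (if insub l is Some i then ('X_(i : 'I_n) : ybase) else 0)%:P.

(* Homogeneity of degree d for deg y_i = 1, deg q = n: if f = p / q^N, then p *)
(* is homogeneous of degree d + n N.                                          *)
Definition qbase_homog (d : int) (f : qbase) : Prop :=
  exists (N : nat) (p : {poly ybase}),
    laurent_val f * tofrac 'X ^+ N = tofrac p /\
    forall i (m : 'X_{1..n}), m \in msupp (p`_i : {mpoly int[n]}) ->
      (mdeg m + n * i)%:Z = d + (n * N)%:Z.

Definition qH_relation (g : sympoly qbase k) : Prop :=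
  (exists r : nat, (n - k + 1 <= r <= n - 1)%N /\ g = fschur_row k yvar r) \/
  g = fschur_row k yvar n + ((-1) ^+ k * qvar)%:A.

Definition qH : Type := quot_alg qH_relation.

HB.instance Definition _ := GRing.ComPzRing.on qH.
HB.instance Definition _ := GRing.Lmodule.on qH.

Definition qH_pi (p : sympoly qbase k) : qH := apr qH_relation p.

Definition Xq : 'M[qbase]_n := \matrix_(i, j)
  (((-1) ^+ (k - 1) * qvar) *+ ((i == 0 :> nat) && (j.+1 == n :> nat))
   + (i == j.+1 :> nat)%:R + yvar i *+ (i == j)).

Definition exterior : Type := ext_power qbase n k.

HB.instance Definition _ := GRing.Lmodule.on exterior.

Definition Xq_op (p : sympoly qbase k) (x : exterior) : exterior :=
  sym_op Xq p x.

Section Kets.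
Hypothesis lekn : (k <= n)%N.

Definition schubert (w : grass n k) : sympoly qbase k :=
  fschur yvar (grass_part lekn w).

Definition schubert_class (w : grass n k) : qH := qH_pi (schubert w).

Definition ket (w : grass n k) : exterior :=
  wedge (fun j => delta_mx (letter lekn w j) 0).

Definition quantum_product (star : exterior -> exterior -> exterior) : Prop :=
  [/\ forall x, linear (star x),
      forall z, linear (star^~ z)
    & forall w u, star (ket w) (ket u) = Xq_op (schubert w) (ket u)].

Definition exterior_homog (d : int) (x : exterior) : Prop :=
  exists c : grass n k -> qbase,
    (forall w, qbase_homog (d - (grass_size lekn w)%:Z) (c w)) /\
    x = \sum_w c w *: ket w.

End Kets.

End EquivariantQuantumCohomology.

Definition graded_ring (A : zmodType) (mul : A -> A -> A) (one : A)
    (piece : int -> A -> Prop) : Prop :=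
  [/\ forall d, piece d 0 /\ (forall x z, piece d x -> piece d z -> piece d (x - z)),
      forall x, exists (s : seq int) (f : int -> A),
        [/\ uniq s, forall d, piece d (f d) & x = \sum_(d <- s) f d],
      forall (s : seq int) (f : int -> A), uniq s -> (forall d, piece d (f d)) ->
        \sum_(d <- s) f d = 0 -> forall d, d \in s -> f d = 0,
      piece 0 one
    & forall d e x z, piece d x -> piece e z -> piece (d + e) (mul x z)].

(* Main.v *)
From HB Require Import structures.
From mathcomp Require Import all_boot all_order all_algebra perm.
From mathcomp Require Import boolp.
From mathcomp Require Import mpoly zify.
Require Import Defs.

Set Implicit Arguments.
Unset Strict Implicit.
Unset Printing Implicit Defensive.

Import GRing.Theory.
Local Open Scope ring_scope.

(** Write K for the ground ring, (x|y)^m for the factorial powers, and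
    F = (x|y)^n - (-1)^(k-1) q.  The matrix [Xq] takes each basis vector to a
    multiple of itself plus the next one, where a multiple of the first vector
    stands in for the one after the last, so that (x|y)^a evaluated at [Xq] sends the first basis vector
    to the (a+1)-st one, and F evaluated at [Xq] kills it: K^n is the cyclic
    module K[x]/(F), with the factorial powers as the standard basis.  The
    whole theorem compares two alternating multilinear functions of k elements
    f_1, ..., f_k of this module: their wedge product, and the bialternant
    det(f_i(x_j)) / det(x_j^(i-1)), a symmetric polynomial ([bialternant]) which
    is a factorial Schur polynomial when the f_i are factorial powers.  A
    symmetric polynomial multiplies either of them by letting each of its
    monomials act on the k arguments, see [sym_mul_bialternant].

    From the exterior power to the quotient ring ([ext_to_quot]).  The
    bialternant of the f_i is a function of the residues of the f_i modulo F once
    it is read in the quotient ring ([bialternant_congr]).  Indeed, bialternants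
    depend linearly on each row, and only through the remainder of that row modulo
    the polynomial [root_poly] with roots x_1, ..., x_k, whose coefficients are
    symmetric.  The relations of the quotient ring are exactly the top
    coefficients of the remainders of F, x F, ..., x^(k-1) F
    ([top_coef_quantum]), and these generate the ideal of all coefficients of the
    remainder of F ([sym_rem_coef0]).

    From the quotient ring to the exterior power ([quot_to_ext]).  Let symmetric
    polynomials act on the wedge of the first k basis vectors.  The bialternant
    of f_1, ..., f_k sends it to the wedge of the f_i
    ([sym_to_ext_bialternant]): after antisymmetrisation, which loses no
    information on the exterior power because its coordinates are minors
    ([alt_inj]), both sides are the action of the numerator det(f_i(x_j)) on the
    k-fold tensor power of the first basis vector ([alt_bialternant_op]).  In
    particular factorial Schur polynomials produce the kets, and the relations,
    being bialternants with a row divisible by F, act as zero.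

    The two maps are inverse to each other, linear over K and compatible with
    the action of symmetric polynomials, so transporting the product of the
    quotient ring gives the required product on the exterior power
    ([quantum_star]).  For the grading, [Xq] raises the degree of tensors by one,
    and a factorial Schur polynomial is homogeneous because the factors x_i - x_j
    can be cancelled from a homogeneous product ([homog_cancel_subX]).
    Decompositions into homogeneous components exist and are unique because the
    kets form a basis ([ext_expand], [ext_coord_ket]) and they do so in the
    ground ring ([qbase_decomposable], [qbase_homog_free]). *)

(** * Linear maps out of quotient modules *)

Section QuotientMaps.
Variables (K : comNzRingType) (M N : lmodType K) (G : M -> Prop).
Variable g : {linear M -> N}.
Hypothesis gG : forall x, G x -> g x = 0.

Lemma linear_span0 x : x \in span G -> g x = 0.
Proof.
case/spanP=> [r [c [h [Gh ->]]]]; rewrite linear_sum big1 // => i _.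
by rewrite linearZ /= gG // scaler0.
Qed.

Lemma linear_repr_qpi x : g (repr (qpi G x)) = g x.
Proof.
apply/eqP; rewrite -subr_eq0 -linearB; apply/eqP/linear_span0.
by apply/qpi_eq; rewrite qpiK.
Qed.

End QuotientMaps.

(** * A basis of the exterior power *)

Section AlternatingTensors.
Variables (K : comNzRingType) (n k : nat).
Implicit Types (t : tensor_power K n k) (w : {ffun 'I_k -> 'I_n}).
Implicit Types (v : 'I_k -> 'cV[K]_n).

HB.instance Definition _ := GRing.isLinear.Build K (tensor_power K n k)
  (ext_power K n k) *:%R (@ext_pi K n k) (qpi_is_linear _).

Lemma tensor_scaleE a t w : (a *: t) w = a * t w.
Proof. by rewrite ffunE. Qed.

Definition basis_tens w : tensor_power K n k := tens (fun i => delta_mx (w i) 0).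

Lemma basis_tensE w w' : basis_tens w w' = (w' == w)%:R.
Proof.
rewrite ffunE; case: eqP => [->|/eqP nw].
  by apply: big1 => i _; rewrite mxE !eqxx.
have [i ni] : exists i, w' i != w i.
  apply/existsP; apply: contraNT nw => /existsPn e.
  by apply/eqP/ffunP => i; apply/eqP/negPn.
by rewrite (bigD1 i) //= mxE (negbTE ni) mul0r.
Qed.

Lemma tensor_expand t : t = \sum_w t w *: basis_tens w.
Proof.
apply/ffunP => w; rewrite sum_ffunE (bigD1 w) //= tensor_scaleE basis_tensE eqxx.
rewrite mulr1 big1 ?addr0 // => w' nw.
by rewrite tensor_scaleE basis_tensE eq_sym (negbTE nw) mulr0.
Qed.

Lemma tens_lin_eq (N : lmodType K) (f g : {linear tensor_power K n k -> N}) :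
  (forall v, f (tens v) = g (tens v)) -> f =1 g.
Proof.
move=> fg t; rewrite [t]tensor_expand !linear_sum; apply: eq_bigr => w _.
by rewrite !linearZ /= fg.
Qed.

Definition perm_tens (s : 'S_k) t : tensor_power K n k :=
  [ffun w : {ffun 'I_k -> 'I_n} => t [ffun i => w (s i)]].

(** Up to reordering, the coordinates of [alt t] are the coefficients of the class
    of [t] in the exterior power, so no division by [k`!] is ever needed to pass
    between the two, see [alt_inj]. *)
Definition alt t : tensor_power K n k :=
  \sum_(s : 'S_k) (-1) ^+ s *: perm_tens s t.

Fact perm_tens_is_linear s : linear (perm_tens s).
Proof. by move=> a t u; apply/ffunP => w; rewrite !ffunE. Qed.
HB.instance Definition _ s := GRing.isLinear.Build K (tensor_power K n k)
  (tensor_power K n k) *:%R (perm_tens s) (perm_tens_is_linear s).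

Fact alt_is_linear : linear alt.
Proof.
move=> a t u; rewrite scaler_sumr -big_split /=; apply: eq_bigr => s _.
by rewrite linearP scalerDr !scalerA mulrC.
Qed.
HB.instance Definition _ := GRing.isLinear.Build K (tensor_power K n k)
  (tensor_power K n k) *:%R alt alt_is_linear.

Lemma altE t w : alt t w = \sum_(s : 'S_k) (-1) ^+ s * t [ffun i => w (s i)].
Proof. by rewrite sum_ffunE; apply: eq_bigr => s _; rewrite !ffunE. Qed.

Lemma alt_tens v w : alt (tens v) w = \det (\matrix_(i, j) v i (w j) 0).
Proof.
rewrite altE; apply: eq_bigr => s _; congr (_ * _); rewrite ffunE.
by apply: eq_bigr => i _; rewrite mxE ffunE.
Qed.

Lemma alt_relator t : alternating_relator t -> alt t = 0.
Proof.
case=> v [[i [j [nij vij]]] ->]; apply/ffunP => w; rewrite alt_tens ffunE.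
by apply: (determinant_alternate nij) => l; rewrite !mxE vij.
Qed.

Lemma ext_pi_eq0 t :
  t \in span (@alternating_relator K n k) -> ext_pi t = 0.
Proof.
have [_ e t0] := qpi_eq (@alternating_relator K n k) t 0.
rewrite subr0 in e; rewrite /ext_pi (e t0).
exact: (linear0 (@ext_pi K n k)).
Qed.

Lemma wedge_tperm v i j : i != j -> wedge (v \o tperm i j) = - wedge v.
Proof.
move=> nij; apply/eqP; rewrite -addr_eq0 /wedge -linearD; apply/eqP/ext_pi_eq0.
apply: etrans (congr1 (fun t => t \in span _) _)
  (@tens_swap_span K n k v i j (v j) (v i) nij).
congr (_ + _); congr tens; apply/funext => l /=.
  by case: tpermP => [->|->|/eqP/negbTE-> /eqP/negbTE->//];
    rewrite ?eqxx // eq_sym (negbTE nij).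
by case: eqP => [->//|_]; case: eqP => [->|].
Qed.

Lemma wedge_perm v (s : 'S_k) : wedge (v \o s) = (-1) ^+ s *: wedge v.
Proof.
have [ts -> tsP] := prod_tpermP s.
elim: ts tsP v => [|[i j] ts IH] /= => [_|/andP[nij tsP]] v.
  rewrite big_nil odd_perm1 scale1r; congr wedge; apply/funext => i /=.
  by rewrite perm1.
rewrite big_cons odd_permM odd_tperm nij signr_addb.
rewrite expr1 mulN1r scaleNr -(IH tsP) -(wedge_tperm _ nij); congr wedge.
by apply/funext => l /=; rewrite permM.
Qed.

Lemma wedge_alternating v i j : i != j -> v i = v j -> wedge v = 0.
Proof.
move=> nij vij; apply/ext_pi_eq0/mem_span.
by exists v; split; first by exists i, j.
Qed.

End AlternatingTensors.

(** * Sorting words with Grassmannian permutations *)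

Section GrassmannianWords.

(** The numbers [s i - i] are nonnegative and sum to zero. *)
Lemma perm_ge_eq1 m (s : 'S_m) : (forall i : 'I_m, i <= s i)%N -> s = 1%g.
Proof.
move=> les; apply/permP => i; rewrite perm1; apply/eqP/negPn/negP => nsi.
have : (\sum_i (s i - i) = 0)%N.
  rewrite sumnB //.
  by rewrite [X in (_ - X)%N](reindex_inj (@perm_inj _ s)) subnn.
move/eqP; rewrite sum_nat_eq0 => /forallP /(_ i) /=; rewrite subn_eq0 => lesi.
by case/negP: nsi; rewrite -val_eqE eqn_leq /= lesi les.
Qed.

(** The first value of either block cannot drop below the start of the block,
    hence by induction along the block no value drops below its position. *)
Lemma grassmannian_eq1 m b (s : 'S_m) : is_grassmannian b s ->
  (forall i : 'I_m, (i < b)%N -> (s i < b)%N) -> s = 1%g.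
Proof.
move=> gs sb; apply: perm_ge_eq1 => -[i lti].
have big_ge (i' : 'I_m) : (b <= i')%N -> (b <= s i')%N.
  pose B := [set a : 'I_m | (a < b)%N].
  have im : [set s a | a in B] = B.
    apply/eqP; rewrite eqEcard card_imset ?leqnn ?andbT; last exact: perm_inj.
    by apply/subsetP => _ /imsetP[a ab ->]; move: ab; rewrite !inE; apply: sb.
  move=> lebi; rewrite leqNgt; apply/negP => ltb.
  have : s i' \in B by rewrite inE.
  rewrite -im => /imsetP[a]; rewrite inE => ab /perm_inj eia.
  by rewrite eia leqNgt ab in lebi.
elim: i => [//|i IHi] in lti *.
have lti' : (i < m)%N by apply: ltnW.
have IH := IHi lti'.
have [bi|nb] := eqVneq i.+1 b.
  by have := big_ge (Ordinal lti); rewrite /= -bi leqnn => ->.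
have /forallP/(_ (Ordinal lti'))/forallP/(_ (Ordinal lti))/implyP := gs.
rewrite /= ltnSn /= => lts; apply: leq_ltn_trans IH _; apply: lts.
by move: nb; case: (ltngtP i.+1 b) => //= ltib _; rewrite -ltnS ltib.
Qed.

Variables (n k : nat) (lekn : (k <= n)%N).
Implicit Types w u : grass n k.

Lemma letter_lt w (i j : 'I_k) :
  (i < j)%N -> (letter lekn w i < letter lekn w j)%N.
Proof.
move=> ltij; have /forallP/(_ (widen_ord lekn i))/forallP := valP w.
by move=> /(_ (widen_ord lekn j))/implyP; apply; rewrite /= ltij ltn_ord.
Qed.

Lemma letter_ge w (i : 'I_k) : (i <= letter lekn w i)%N.
Proof.
case: i => i lti; elim: i => [//|i IHi] in lti *.
apply: leq_ltn_trans (IHi (ltnW lti)) _; exact: letter_lt.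
Qed.

(** In both conclusions a permutation increasing on the two blocks and preserving
    the first one is shown to be trivial: [s] itself, whose second block is empty,
    and then the quotient of [w] by [u]. *)
Lemma letter_perm w u (s : 'S_k) :
  (forall i, letter lekn w (s i) = letter lekn u i) -> s = 1%g /\ w = u.
Proof.
move=> ws; have s1 : s = 1%g.
  apply: (@grassmannian_eq1 k k) => //.
  apply/forallP => i; apply/forallP => j; apply/implyP => /andP[ltij _].
  rewrite ltnNge leq_eqVlt negb_or; apply/andP; split.
    rewrite eq_sym val_eqE (inj_eq (@perm_inj _ s)); apply/eqP => eij.
    by rewrite eij ltnn in ltij.
  by apply/negP => /(letter_lt w); rewrite !ws ltnNge ltnW // letter_lt.
split=> //; apply: val_inj.
have lew (i : 'I_n) : (i < k)%N -> val w i = val u i.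
  move=> ik; have := ws (Ordinal ik); rewrite s1 perm1 /letter.
  by have -> : widen_ord lekn (Ordinal ik) = i by exact: val_inj.
pose r := (val w * (val u)^-1)%g.
have rE i : val u (r i) = val w i by rewrite permM permKV.
suff r1 : r = 1%g by apply/permP => i; rewrite -rE r1 perm1.
have rlt (i : 'I_n) : (i < k)%N -> r i = i.
  by move=> ik; apply: (@perm_inj _ (val u)); rewrite rE lew.
have rge (i : 'I_n) : (k <= i)%N -> (k <= r i)%N.
  move=> ki; rewrite leqNgt; apply/negP => rik; have := rlt _ rik.
  by move=> /perm_inj eri; rewrite eri ltnNge ki in rik.
apply: (@grassmannian_eq1 n k); last by move=> i ik; rewrite rlt.
apply/forallP => i; apply/forallP => j; apply/implyP => /andP[ltij].
case/orP => [jk|ki]; first by rewrite !rlt // (ltn_trans ltij).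
have gr (x : grass n k) (a b : 'I_n) :
    (k <= a)%N -> (a < b)%N -> (val x a < val x b)%N.
  move=> ka ab; have /forallP/(_ a)/forallP/(_ b)/implyP := valP x.
  by rewrite ab ka orbT; apply.
have kj : (k <= j)%N by rewrite ltnW // (leq_ltn_trans ki).
rewrite ltnNge leq_eqVlt negb_or; apply/andP; split.
  by apply/negP => /eqP/val_inj/perm_inj e; rewrite e ltnn in ltij.
by apply/negP => /(gr u _ _ (rge _ kj)); rewrite !rE ltnNge ltnW // gr.
Qed.

Lemma sorted_enum_pred m (P : {pred 'I_m}) :
  sorted (fun a b : 'I_m => (a < b)%N) (enum P).
Proof.
have -> : enum P = [seq a <- enum 'I_m | a \in P] by rewrite enumT.
apply: sorted_filter; first by move=> a b c; exact: ltn_trans.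
by have := iota_ltn_sorted 0 m; rewrite -val_enum_ord sorted_map.
Qed.

(** [w] lists the letters of [f] in increasing order and then the remaining ones,
    again in increasing order. *)
Lemma injective_word_sort (f : 'I_k -> 'I_n) : injective f ->
  exists w, exists s : 'S_k, forall i, f i = letter lekn w (s i).
Proof.
move=> finj; pose A : {pred 'I_n} := [pred a | a \in codom f].
pose s1 := enum A; pose s2 := enum [predC A].
have sz1 : size s1 = k.
  by rewrite -cardE -[RHS]card_ord -(card_codom finj); exact: eq_card.
have sz12 : size (s1 ++ s2) = n.
  by rewrite size_cat -!cardE cardC card_ord.
have us : uniq (s1 ++ s2).
  rewrite cat_uniq !enum_uniq andbT /=; apply/hasPn => a.
  by rewrite !mem_enum inE.
pose g (i : 'I_n) := nth i (s1 ++ s2) i.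
have ginj : injective g.
  move=> i j /eqP; rewrite /g (set_nth_default i j) ?sz12 //.
  by rewrite nth_uniq ?sz12 // => /eqP/val_inj.
have gE (x0 i : 'I_n) :
    g i = if (i < k)%N then nth x0 s1 i else nth x0 s2 (i - k).
  by rewrite /g (set_nth_default x0) ?sz12 // nth_cat sz1.
have lt_tr : transitive (fun a b : 'I_n => (a < b)%N).
  by move=> a b c; exact: ltn_trans.
have gg : is_grassmannian k (perm ginj).
  apply/forallP => i; apply/forallP => j; apply/implyP => /andP[ltij].
  rewrite !permE !(gE i); case/orP => [jk|ki].
    rewrite jk (ltn_trans ltij jk).
    have /(_ i j) := sorted_ltn_nth lt_tr i (sorted_enum_pred A).
    by rewrite !inE sz1 jk (ltn_trans ltij jk); apply.
  have kj := leq_trans ki (ltnW ltij); rewrite !(ltnNge _ k) ki kj /=.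
  have sz2 : size s2 = (n - k)%N.
    by rewrite -(addKn k (size s2)) -sz1 -size_cat sz12 sz1.
  have /(_ (i - k)%N (j - k)%N) :=
    sorted_ltn_nth lt_tr i (sorted_enum_pred [predC A]).
  have kj' := leq_ltn_trans ki ltij; have kn := ltn_trans kj' (ltn_ord j).
  rewrite !inE sz2; apply; first exact: ltn_sub2r kn (ltn_ord i).
    exact: ltn_sub2r kn (ltn_ord j).
  exact: ltn_sub2r kj' ltij.
have f1 i : f i \in s1 by rewrite mem_enum; exact: codom_f.
have idx_lt i : (index (f i) s1 < k)%N by rewrite -sz1 index_mem.
pose h i : 'I_k := Ordinal (idx_lt i).
have hinj : injective h.
  move=> i j /(congr1 val) /= e; apply: finj.
  by rewrite -(nth_index (f i) (f1 i)) e nth_index.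
exists (exist (fun w : 'S_n => is_true (is_grassmannian k w)) _ gg).
exists (perm hinj) => i.
rewrite /letter /= !permE (gE (f i)) /= idx_lt; exact/esym/nth_index.
Qed.

Fact is_grassmannian1 : is_grassmannian k (1%g : 'S_n).
Proof.
apply/forallP => i; apply/forallP => j; apply/implyP => /andP[ltij _].
by rewrite !perm1.
Qed.

Definition grass1 : grass n k :=
  exist (fun w : 'S_n => is_true (is_grassmannian k w)) _ is_grassmannian1.

Lemma letter1 i : letter lekn grass1 i = widen_ord lekn i.
Proof. by rewrite /letter perm1. Qed.

End GrassmannianWords.

(** * The basis of kets *)

Section ExteriorBasis.
Variables (K : comNzRingType) (n k : nat) (lekn : (k <= n)%N).
Implicit Types w u : grass n k.

Definition grass_word w : {ffun 'I_k -> 'I_n} := [ffun i => letter lekn w i].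

(** [ket] over an arbitrary ring of scalars. *)
Definition ket_wedge w : ext_power K n k :=
  wedge (fun i => delta_mx (letter lekn w i) 0).

(** On a wedge product, the minor of its vectors on the rows that the word of [w]
    selects. *)
Definition ext_coord w (x : ext_power K n k) : K := alt (repr x) (grass_word w).

Lemma ext_coord_pi w t : ext_coord w (ext_pi t) = alt t (grass_word w).
Proof. by rewrite /ext_coord (linear_repr_qpi (@alt_relator K n k)). Qed.

Fact ext_coord_is_linear w : linear_for *%R (ext_coord w).
Proof.
move=> a x y; rewrite -[x]qpiK -[y]qpiK -!/(ext_pi _) -linearP !ext_coord_pi.
by rewrite linearP !ffunE.
Qed.
HB.instance Definition _ w := GRing.isLinear.Build K (ext_power K n k) K *%R
  (ext_coord w) (ext_coord_is_linear w).

Lemma ext_coord0 w : ext_coord w 0 = 0.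
Proof. exact: linear0. Qed.

Lemma ext_coordD w x z : ext_coord w (x + z) = ext_coord w x + ext_coord w z.
Proof. exact: linearD. Qed.

Lemma ext_coordB w x z : ext_coord w (x - z) = ext_coord w x - ext_coord w z.
Proof. exact: linearB. Qed.

Lemma ext_coordZ w a x : ext_coord w (a *: x) = a * ext_coord w x.
Proof. exact: linearZ. Qed.

Lemma ext_coord_sum w I (s : seq I) (P : pred I) (F : I -> ext_power K n k) :
  ext_coord w (\sum_(i <- s | P i) F i) = \sum_(i <- s | P i) ext_coord w (F i).
Proof. exact: linear_sum. Qed.

(** Only a permutation that sorts the word of [w] into that of [u] contributes. *)
Lemma ext_coord_ket w u : ext_coord w (ket_wedge u) = (w == u)%:R.
Proof.
have -> : ket_wedge u = ext_pi (basis_tens K (grass_word u)).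
  by congr (ext_pi (tens _)); apply/funext => i; rewrite ffunE.
rewrite ext_coord_pi altE.
have [s wsu|nws] := pickP (fun s : 'S_k =>
    [ffun i => grass_word w (s i)] == grass_word u).
  have [s1 wu] : s = 1%g /\ w = u.
    apply: letter_perm => i.
    by have /eqP/ffunP/(_ i) := wsu; rewrite !ffunE.
  rewrite wu eqxx (bigD1 (1%g : 'S_k)) //= big1 => [|s' ns'].
    rewrite odd_perm1 mul1r addr0 basis_tensE.
    suff -> : [ffun i => grass_word u ((1%g : 'S_k) i)] = grass_word u.
      by rewrite eqxx.
    by apply/ffunP => i; rewrite !ffunE perm1.
  rewrite basis_tensE; case: eqP => [/ffunP e|_]; last by rewrite mulr0.
  case/negP: ns'; apply/eqP.
  suff [] : s' = 1%g /\ u = u by [].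
  by apply: letter_perm => i; have := e i; rewrite !ffunE.
rewrite big1 => [|s _]; last by rewrite basis_tensE nws mulr0.
case: eqP => [wu|//]; have := nws (1%g : 'S_k); rewrite wu => /eqP[].
by apply/ffunP => i; rewrite !ffunE perm1.
Qed.

(** A word with a repeated letter contributes zero, and any other one is a signed
    reordering of a Grassmannian word. *)
Lemma ket_span (x : ext_power K n k) : exists c, x = \sum_w c w *: ket_wedge w.
Proof.
pose S := fun x => exists c, x = \sum_w c w *: ket_wedge w.
have SD y z : S y -> S z -> S (y + z).
  case=> [c ->] [d ->]; exists (fun w => c w + d w).
  by rewrite -big_split; apply: eq_bigr => w _; rewrite scalerDl.
have SZ a y : S y -> S (a *: y).
  case=> [c ->]; exists (fun w => a * c w).
  by rewrite scaler_sumr; apply: eq_bigr => w _; rewrite scalerA.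
have S0 : S 0 by exists (fun=> 0); rewrite big1 // => w _; rewrite scale0r.
rewrite -/(S x) -[x]qpiK -/(ext_pi _) [repr x]tensor_expand linear_sum.
elim/big_ind: _ => [||f _] //.
rewrite linearZ; apply: (SZ).
have [/injectiveP finj|/injectivePn[i [j nij fij]]] := boolP (injectiveb f).
  have [w [s fE]] := injective_word_sort lekn finj.
  exists (fun u => (-1) ^+ s * (u == w)%:R).
  rewrite (bigD1 w) //= big1 => [|u /negbTE->]; last by rewrite mulr0 scale0r.
  rewrite eqxx mulr1 addr0 -wedge_perm; congr (ext_pi (tens _)).
  by apply/funext => i /=; rewrite fE.
suff e : wedge (fun i => delta_mx (f i) 0) = 0 :> ext_power K n k.
  by change (S (wedge (fun i => delta_mx (f i) 0))); rewrite e.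
by apply: (wedge_alternating nij) => /=; rewrite fij.
Qed.

Lemma ext_coord_sum_ket (c : grass n k -> K) w :
  ext_coord w (\sum_u c u *: ket_wedge u) = c w.
Proof.
rewrite ext_coord_sum (bigD1 w) //= ext_coordZ ext_coord_ket eqxx mulr1.
rewrite big1 ?addr0 // => u nu.
by rewrite ext_coordZ ext_coord_ket eq_sym (negbTE nu) mulr0.
Qed.

Lemma ext_expand (x : ext_power K n k) :
  x = \sum_w ext_coord w x *: ket_wedge w.
Proof.
have [c xE] := ket_span x; rewrite {1}xE; apply: eq_bigr => w _.
by rewrite xE ext_coord_sum_ket.
Qed.

Lemma ext_coord_inj (x z : ext_power K n k) :
  (forall w, ext_coord w x = ext_coord w z) -> x = z.
Proof.
move=> e; rewrite [x]ext_expand [z]ext_expand.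
by apply: eq_bigr => w _; rewrite e.
Qed.

Lemma alt_inj (t t' : tensor_power K n k) :
  alt t = alt t' -> ext_pi t = ext_pi t'.
Proof. by move=> e; apply: ext_coord_inj => w; rewrite !ext_coord_pi e. Qed.

End ExteriorBasis.

Lemma coefK_wide (R : nzSemiRingType) n (p : {poly R}) :
  (size p <= n)%N -> \poly_(i < n) p`_i = p.
Proof.
move=> szp; apply/polyP => i; rewrite coef_poly; case: ltnP => // le_ni.
by rewrite nth_default // (leq_trans szp).
Qed.

(** * Alternants and their quotients by the Vandermonde determinant *)

Section SymmetricValues.
Variables (K : comNzRingType) (k : nat).
Implicit Types p r : sympoly K k.

HB.instance Definition _ := GRing.RMorphism.copy (@sympoly_val K k)
  (val : sympoly K k -> {mpoly K[k]}).
HB.instance Definition _ := GRing.Linear.copy (@sympoly_val K k)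
  (val : sympoly K k -> {mpoly K[k]}).

Lemma sympoly_valZ a p : sympoly_val (a *: p) = a *: sympoly_val p.
Proof. exact: linearZ. Qed.

Lemma sympoly_valM p r : sympoly_val (p * r) = sympoly_val p * sympoly_val r.
Proof. exact: rmorphM. Qed.

Lemma sympoly_val1 : sympoly_val (1 : sympoly K k) = 1.
Proof. exact: rmorph1. Qed.

Lemma sympoly_val0 : sympoly_val (0 : sympoly K k) = 0.
Proof. exact: rmorph0. Qed.

Lemma sympoly_val_sum I (r : seq I) (P : pred I) (F : I -> sympoly K k) :
  sympoly_val (\sum_(i <- r | P i) F i) = \sum_(i <- r | P i) sympoly_val (F i).
Proof. exact: linear_sum. Qed.

End SymmetricValues.

Section Alternants.
Variables (K : idomainType) (k : nat).
Implicit Types (f g : 'I_k -> {poly K}) (u : {poly K}) (s : 'S_k).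

Definition polyX (j : 'I_k) : {poly K} -> {mpoly K[k]} :=
  horner_alg ('X_j : {mpoly K[k]}).
HB.instance Definition _ j := GRing.RMorphism.on (polyX j).
HB.instance Definition _ j := GRing.Linear.on (polyX j).

Lemma polyX_X j : polyX j 'X = 'X_j. Proof. exact: horner_algX. Qed.
Lemma polyX_Xn j l : polyX j 'X^l = 'X_j ^+ l.
Proof. by rewrite rmorphXn /= polyX_X. Qed.
Lemma polyX_sum j I (r : seq I) (P : pred I) (F : I -> {poly K}) :
  polyX j (\sum_(i <- r | P i) F i) = \sum_(i <- r | P i) polyX j (F i).
Proof. exact: linear_sum. Qed.
Lemma polyX_Z j c u : polyX j (c *: u) = c *: polyX j u.
Proof. by rewrite linearZ /= mulr_algl. Qed.
Lemma polyX_C j c : polyX j c%:P = c%:A. Proof. exact: horner_algC. Qed.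

Lemma msym_polyX s j u : msym s (polyX j u) = polyX (s j) u.
Proof.
elim/poly_ind: u => [|u c IHu]; first by rewrite !raddf0.
rewrite !rmorphD !rmorphM /= IHu !polyX_X !polyX_C msymZ rmorph1.
by rewrite /msym mmapX mmap1U.
Qed.

(** The rows are in increasing order, opposite to the numerator of a factorial Schur
    polynomial: the two differ by the sign of [rev_perm]. *)
Definition alternant f : {mpoly K[k]} := \det (\matrix_(i, j) polyX j (f i)).

Definition vdm : {mpoly K[k]} := alternant (fun i => 'X^i).

Lemma alternantE f :
  alternant f = \sum_(s : 'S_k) (-1) ^+ s * \prod_i polyX (s i) (f i).
Proof.
apply: eq_bigr => s _; congr (_ * _).
by apply: eq_bigr => i _; rewrite mxE.
Qed.

Lemma msym_alternant s f : msym s (alternant f) = (-1) ^+ s * alternant f.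
Proof.
rewrite -det_map_mx [X in \det X](_ : _ = col_perm s (\matrix_(i, j)
  polyX j (f i))); last first.
  by apply/matrixP => i j; rewrite !mxE; exact: msym_polyX.
by rewrite col_permE det_mulmx det_perm odd_permV mulrC.
Qed.

Lemma alternant_alternating f i j : i != j -> f i = f j -> alternant f = 0.
Proof.
by move=> nij fij; apply: (determinant_alternate nij) => l; rewrite !mxE fij.
Qed.

(** With few enough coefficients, the alternant factors through the matrix of
    coefficients. *)
Lemma alternant_coef f : (forall i, size (f i) <= k)%N ->
  alternant f = (\det (\matrix_(i, l < k) (f i)`_l))%:A * vdm.
Proof.
move=> sf; rewrite -[X in X * _](det_map_mx (in_alg {mpoly K[k]})).
rewrite /vdm /alternant -det_mulmx.
congr (\det _); apply/matrixP => i j; rewrite !mxE -{1}[f i](coefK_wide (sf i)).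
rewrite poly_def polyX_sum; apply: eq_bigr => l _.
by rewrite !mxE polyX_Z mulr_algl.
Qed.

Lemma alternant_monic f :
  (forall i, f i \is monic) -> (forall i, size (f i) = i.+1) -> alternant f = vdm.
Proof.
move=> mf sf; rewrite alternant_coef => [|i]; last by rewrite sf.
rewrite det_trig => [|]; last first.
  by apply/is_trig_mxP => i j ltij; rewrite mxE nth_default // sf.
rewrite big1 ?scale1r ?mul1r // => i _; rewrite mxE.
by have /monicP := mf i; rewrite lead_coefE sf.
Qed.

(** Reversing the order of the rows: this accounts for the decreasing exponents
    in the classical bialternant. *)
Definition rev_perm : 'S_k := perm (@rev_ord_inj k).

Lemma alternant_rev f :
  alternant (f \o @rev_ord k) = (-1) ^+ rev_perm * alternant f.
Proof.
rewrite /alternant [X in \det X](_ : _ = row_perm rev_perm (\matrix_(i, j)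
  polyX j (f i))); first by rewrite row_permE det_mulmx det_perm.
by apply/matrixP => i j; rewrite !mxE permE.
Qed.

(** Permuting the variables by the reversal exchanges [x_i - x_j] for
    [x_j - x_i], with [i < j], in the product formula. *)
Lemma fschur_den_vdm : fschur_den K k = (-1) ^+ rev_perm * vdm.
Proof.
rewrite -msym_alternant /alternant.
have -> : \det (\matrix_(i, j) polyX j 'X^i) =
    \det (Vandermonde k (\row_j ('X_j : {mpoly K[k]}))).
  by congr (\det _); apply/matrixP => i j; rewrite !mxE rmorphXn /= polyX_X.
rewrite det_Vandermonde rmorph_prod /=.
under [RHS]eq_bigr => i _ do rewrite rmorph_prod /=.
rewrite /fschur_den pair_big_dep [RHS]pair_big_dep /=.
pose h (p : 'I_k * 'I_k) := (rev_ord p.2, rev_ord p.1).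
have hK : involutive h by case=> i j; rewrite /h /= !rev_ordK.
rewrite (reindex_inj (inv_inj hK)) /=; apply: eq_big => [[i j]|[i j] _] /=.
  by rewrite ltn_sub2lE //; have := ltn_ord j; lia.
by rewrite !mxE rmorphB /= /msym !mmapX !mmap1U !permE.
Qed.

Lemma vdm_neq0 : vdm != 0.
Proof.
apply/eqP => v0; have := fschur_den_neq0 K k.
by rewrite fschur_den_vdm v0 mulr0 eqxx.
Qed.

Lemma vdm_inj (p r : sympoly K k) :
  (p : {mpoly K[k]}) * vdm = (r : {mpoly K[k]}) * vdm -> p = r.
Proof. by move/(mulIf vdm_neq0)/val_inj. Qed.

Fact alternant_quot_exists f : exists p : {mpoly K[k]}, p * vdm == alternant f.
Proof.
pose F i := map_poly (in_alg {mpoly K[k]}) (f i).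
have [p pE] := vandermonde_dvd (fun i : 'I_k => 'X_i : {mpoly K[k]}) F.
exists (p * (-1) ^+ rev_perm); rewrite -mulrA -fschur_den_vdm pE.
by apply/eqP; congr (\det _); apply/matrixP => i j; rewrite !mxE.
Qed.

Fact alternant_quot_sym f : xchoose (alternant_quot_exists f) \is symmetric.
Proof.
apply/issymP => s; apply: (mulIf vdm_neq0).
apply: (@mulfI _ ((-1) ^+ s)); first by rewrite signr_eq0.
rewrite mulrCA -msym_alternant -msymM.
by rewrite (eqP (xchooseP (alternant_quot_exists f))) msym_alternant.
Qed.

(** The factorial Schur polynomials are the values at factorial powers, see
    [fschur_bialternant]. Allowing arbitrary polynomials as rows makes the quotient
    alternating and multilinear, like a wedge product. *)
Definition bialternant f : sympoly K k := MkSympoly (alternant_quot_sym f).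

Lemma bialternantE f : (bialternant f : {mpoly K[k]}) * vdm = alternant f.
Proof. exact/eqP/(xchooseP (alternant_quot_exists f)). Qed.

Lemma bialternant_alternating f i j :
  i != j -> f i = f j -> bialternant f = 0.
Proof.
move=> nij fij; apply: vdm_inj.
by rewrite bialternantE (alternant_alternating nij fij) sympoly_val0 mul0r.
Qed.

Lemma bialternant_monic f :
  (forall i, f i \is monic) -> (forall i, size (f i) = i.+1) ->
  bialternant f = 1.
Proof.
move=> mf sf; apply: vdm_inj.
by rewrite bialternantE (alternant_monic mf sf) sympoly_val1 mul1r.
Qed.

Lemma bialternant_expand N (c : 'I_k -> 'I_N -> K) (g : 'I_N -> {poly K}) :
  bialternant (fun i => \sum_a c i a *: g a) =
  \sum_(w : {ffun 'I_k -> 'I_N}) (\prod_i c i (w i)) *: bialternant (g \o w).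
Proof.
apply: vdm_inj; rewrite bialternantE sympoly_val_sum mulr_suml.
under [RHS]eq_bigr => w _ do rewrite sympoly_valZ -scalerAl bialternantE.
rewrite alternantE.
under [LHS]eq_bigr => s _.
  under eq_bigr => i _ do rewrite polyX_sum.
  rewrite bigA_distr_bigA mulr_sumr /=.
  over.
rewrite exchange_big; apply: eq_bigr => w _.
rewrite alternantE scaler_sumr; apply: eq_bigr => s _.
under eq_bigr => i _ do rewrite polyX_Z.
by rewrite scaler_prod -scalerAr.
Qed.

(** A symmetric factor may be moved inside the antisymmetrisation, where its
    monomials act on the individual variables. *)
Lemma sym_mul_bialternant (p : sympoly K k) f :
  p * bialternant f =
  \sum_(m <- msupp p) (p : {mpoly K[k]})@_m *:
     bialternant (fun i => 'X^(m i) * f i).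
Proof.
apply: vdm_inj; rewrite sympoly_valM -mulrA bialternantE sympoly_val_sum mulr_suml.
under [RHS]eq_bigr => m _ do rewrite sympoly_valZ -scalerAl bialternantE.
rewrite alternantE mulr_sumr.
under [RHS]eq_bigr => m _ do rewrite alternantE scaler_sumr.
rewrite [RHS]exchange_big; apply: eq_bigr => s _ /=.
have /issymP/(_ s) := sympolyP p; rewrite {1}/msym /mmap => pE.
rewrite -{1}pE mulr_suml; apply: eq_bigr => m _.
under [in RHS]eq_bigr => i _ do rewrite rmorphM rmorphXn /= polyX_X.
by rewrite big_split /= mul_mpolyC -scalerAl mulrCA.
Qed.

Section FactorialPowers.
Variable y : nat -> K.

(* (x | y)^m *)
Definition factorial_power m : {poly K} := \prod_(l < m) ('X - (y l)%:P).

Lemma factorial_powerS m :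
  factorial_power m.+1 = factorial_power m * ('X - (y m)%:P).
Proof. by rewrite /factorial_power big_ord_recr. Qed.

Lemma monic_factorial_power m : factorial_power m \is monic.
Proof. exact: monic_prod_XsubC. Qed.

Lemma size_factorial_power m : size (factorial_power m) = m.+1.
Proof. by rewrite size_prod_XsubC /index_enum -enumT size_enum_ord. Qed.

Lemma fact_power_polyX j m :
  fact_power y ('X_j : {mpoly K[k]}) m = polyX j (factorial_power m).
Proof.
rewrite /fact_power rmorph_prod; apply: eq_bigr => l _.
by rewrite rmorphB /= polyX_X polyX_C.
Qed.

Lemma fschur_bialternant (lam : 'I_k -> nat) : fschur y lam =
  bialternant (fun i => factorial_power (lam (rev_ord i) + i)).
Proof.
apply: vdm_inj; rewrite [RHS]bialternantE.
apply: (@mulfI _ ((-1) ^+ rev_perm)); first by rewrite signr_eq0.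
rewrite mulrCA -fschur_den_vdm fschurE -alternant_rev; congr (\det _).
by apply/matrixP => i j; rewrite !mxE fact_power_polyX /= rev_ordK.
Qed.

(** Newton interpolation: factorial powers are monic of each degree. *)
Lemma newton_expand N (u : {poly K}) : (size u <= N)%N ->
  exists c : 'I_N -> K, u = \sum_a c a *: factorial_power a.
Proof.
elim: N u => [|N IHN] u szu.
  exists (fun=> 0); rewrite big_ord0; apply/eqP.
  by rewrite -size_poly_leq0.
have [|c cE] := IHN (u - u`_N *: factorial_power N).
  apply/leq_sizeP => j; rewrite leq_eqVlt => /orP[/eqP<-|ltNj].
    have /monicP := monic_factorial_power N.
    rewrite lead_coefE size_factorial_power coefB coefZ => ->.
    by rewrite mulr1 subrr.
  rewrite coefB coefZ (nth_default _ (leq_trans szu ltNj)).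
  rewrite [X in _ * X]nth_default ?mulr0 ?subr0 //.
  by rewrite size_factorial_power.
exists (fun a => if unlift ord_max a is Some b then c b else u`_N).
rewrite big_ord_recr /= unlift_none -[LHS](subrK (u`_N *: factorial_power N)).
rewrite cE; congr (_ + _); apply: eq_bigr => a _.
suff -> : unlift ord_max (widen_ord (leqnSn N) a) = Some a by [].
by have -> : widen_ord (leqnSn N) a = lift ord_max a;
  [apply: val_inj; rewrite /= /bump leqNgt ltn_ord|rewrite liftK].
Qed.

End FactorialPowers.

End Alternants.

(** * Reduction modulo the polynomial whose roots are the variables *)

Lemma horner_prod_XsubC0 (A : comNzRingType) (I : finType) (x : I -> A) j :
  (\prod_i ('X - (x i)%:P)).[x j] = 0.
Proof. by rewrite horner_prod (bigD1 j) //= hornerXsubC subrr mul0r. Qed.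

Section RootPolynomial.
Variables (K : idomainType) (k : nat).
Implicit Types (f g : 'I_k -> {poly K}) (u v : {poly K}).

Let root_prod : {poly {mpoly K[k]}} := \prod_(j < k) ('X - ('X_j)%:P).

Let root_prod_coef_sym i : root_prod`_i \is symmetric.
Proof.
apply/issymP => s.
suff e : map_poly (msym s) root_prod = root_prod by rewrite -{2}e coef_map.
rewrite rmorph_prod [RHS](reindex_inj (@perm_inj _ s)); apply: eq_bigr => j _.
by rewrite rmorphB /= map_polyX map_polyC /= /msym mmapX mmap1U.
Qed.

(** The polynomial with the variables as roots, with its coefficients seen in
    the ring of symmetric polynomials. *)
Definition root_poly : {poly sympoly K k} :=
  \poly_(i < k.+1) MkSympoly (root_prod_coef_sym i).

Let size_root_prod : size root_prod = k.+1.
Proof. by rewrite size_prod_XsubC /index_enum -enumT size_enum_ord. Qed.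

Let root_prod_lead : root_prod`_k = 1.
Proof.
have /monicP : root_prod \is monic by apply: monic_prod_XsubC.
by rewrite lead_coefE size_root_prod.
Qed.

Lemma size_root_poly : size root_poly = k.+1.
Proof.
apply: size_poly_eq => /=; apply/eqP => /(congr1 (@sympoly_val K k)).
by rewrite sympoly_val0 /= root_prod_lead => /eqP; rewrite oner_eq0.
Qed.

Lemma monic_root_poly : root_poly \is monic.
Proof.
apply/monicP; rewrite lead_coefE size_root_poly coef_poly ltnSn.
by apply: val_inj; rewrite [RHS]sympoly_val1 -root_prod_lead.
Qed.

Let map_root_poly : map_poly (@sympoly_val K k) root_poly = root_prod.
Proof.
apply/polyP => i; rewrite coef_map coef_poly /=; case: ltnP => [//|ki].
by rewrite sympoly_val0 nth_default // size_root_prod.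
Qed.

Definition eval_var (j : 'I_k) (u : {poly sympoly K k}) : {mpoly K[k]} :=
  (map_poly (@sympoly_val K k) u).['X_j].

Lemma eval_varD j (u v : {poly sympoly K k}) :
  eval_var j (u + v) = eval_var j u + eval_var j v.
Proof. by rewrite /eval_var rmorphD hornerD. Qed.

Lemma eval_varM j (u v : {poly sympoly K k}) :
  eval_var j (u * v) = eval_var j u * eval_var j v.
Proof. by rewrite /eval_var rmorphM hornerM. Qed.

Lemma eval_varC j c : eval_var j c%:P = c.
Proof. by rewrite /eval_var map_polyC hornerC. Qed.

Lemma eval_var_const j u :
  eval_var j (map_poly (in_alg (sympoly K k)) u) = polyX j u.
Proof.
elim/poly_ind: u => [|u c IHu]; 
  first by rewrite !rmorph0 /eval_var rmorph0 horner0.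
have eX : eval_var j 'X = 'X_j by rewrite /eval_var map_polyX hornerX.
rewrite 2!rmorphD 2!rmorphM /= eval_varD eval_varM IHu polyX_X polyX_C.
rewrite map_polyX map_polyC eval_varC eX; congr (_ + _).
Qed.

Lemma eval_var_root_poly j : eval_var j root_poly = 0.
Proof.
by rewrite /eval_var map_root_poly; exact: horner_prod_XsubC0.
Qed.

(** The remainder in [t] of [u(t)] modulo the polynomial with the variables as
    roots: it takes the same values as [u] at the variables, see
    [polyX_sym_rem]. *)
Definition sym_rem u : {poly sympoly K k} :=
  Pdiv.Ring.rmodp (map_poly (in_alg (sympoly K k)) u) root_poly.

Lemma size_sym_rem u : (size (sym_rem u) <= k)%N.
Proof.
by rewrite -ltnS -size_root_poly Pdiv.Ring.ltn_rmodpN0 // monic_neq0 //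
  monic_root_poly.
Qed.

Lemma polyX_sym_rem j u :
  polyX j u = \sum_(l < k) ((sym_rem u)`_l : {mpoly K[k]}) * 'X_j ^+ l.
Proof.
rewrite -eval_var_const.
rewrite [X in eval_var _ X](Pdiv.RingMonic.rdivp_eq monic_root_poly).
rewrite -/(sym_rem u) eval_varD eval_varM eval_var_root_poly mulr0 add0r.
rewrite /eval_var (horner_coef_wide _ (n := k)).
  by apply: eq_bigr => l _; rewrite coef_map.
exact: leq_trans (size_poly _ _) (size_sym_rem u).
Qed.

Lemma sym_remD u v : sym_rem (u + v) = sym_rem u + sym_rem v.
Proof. by rewrite /sym_rem rmorphD Pdiv.RingMonic.rmodpD ?monic_root_poly. Qed.

Lemma sym_rem_mul u v : sym_rem (u * v) =
  \sum_(l < k) (sym_rem v)`_l *: sym_rem (u * 'X^l).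
Proof.
have mP := monic_root_poly.
rewrite /sym_rem rmorphM -Pdiv.RingMonic.rmodp_mulmr // -/(sym_rem v) /=.
rewrite -[X in _ * X](coefK_wide (size_sym_rem v)) poly_def mulr_sumr.
rewrite Pdiv.RingMonic.rmodp_sum //; apply: eq_bigr => l _.
rewrite -scalerAr Pdiv.RingMonic.rmodpZ //; congr (_ *: Pdiv.Ring.rmodp _ _).
by rewrite rmorphM /= map_polyXn.
Qed.

Lemma sym_rem_Xn l : (l < k)%N -> sym_rem 'X^l = 'X^l.
Proof.
move=> lk; rewrite /sym_rem map_polyXn Pdiv.Ring.rmodp_small //.
by rewrite size_polyXn size_root_poly.
Qed.

(** The entries of row [i0] only depend on the remainder of [f i0]. *)
Lemma bialternant_row f i0 : bialternant f =
  \sum_(l < k) (sym_rem (f i0))`_l *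
    bialternant (fun i => if i == i0 then 'X^l else f i).
Proof.
apply: vdm_inj; rewrite bialternantE sympoly_val_sum mulr_suml.
under [RHS]eq_bigr => l _ do rewrite sympoly_valM -mulrA bialternantE.
have cofE (l : 'I_k) j : cofactor (\matrix_(i, j) polyX j
      (if i == i0 then 'X^l else f i)) i0 j =
    cofactor (\matrix_(i, j) polyX j (f i)) i0 j.
  rewrite /cofactor; congr (_ * \det _); apply/matrixP => a b; rewrite !mxE.
  by rewrite eq_sym (negbTE (neq_lift _ _)).
rewrite /alternant (expand_det_row _ i0).
under [RHS]eq_bigr => l _ do rewrite (expand_det_row _ i0) mulr_sumr.
rewrite [RHS]exchange_big; apply: eq_bigr => j _.
rewrite !mxE polyX_sym_rem mulr_suml; apply: eq_bigr => l _.
by rewrite cofE mxE eqxx polyX_Xn [RHS]mulrA.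
Qed.

End RootPolynomial.

(** * Rows modulo a polynomial, and the ideal that makes this possible *)

Section QuotientAlgebraFacts.
Variables (K : comNzRingType) (A : comAlgType K) (gens : A -> Prop).

Lemma apr0 : apr gens 0 = 0.
Proof. exact: (linear0 (qpi (multiple_of_gen gens))). Qed.

Lemma apr_sum I (r : seq I) (P : pred I) (F : I -> A) :
  apr gens (\sum_(i <- r | P i) F i) = \sum_(i <- r | P i) apr gens (F i).
Proof. exact: (linear_sum (qpi (multiple_of_gen gens))). Qed.

Lemma apr_gen g : gens g -> apr gens g = 0.
Proof.
move=> gg; rewrite -apr0; apply/(qpi_eq (multiple_of_gen gens)).
by rewrite subr0; apply: mem_span; exists 1, g; rewrite mul1r.
Qed.

End QuotientAlgebraFacts.

Section BialternantReduction.
Variables (K : idomainType) (k : nat) (gens : sympoly K k -> Prop).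
Variable F : {poly K}.
Local Notation "\pi x" := (apr gens x) (at level 10, x at level 8).

Hypothesis top_coef0 : forall j : 'I_k,
  \pi ((sym_rem k (F * 'X^j))`_k.-1) = 0.

(** Multiplying by the variable shifts the remainder of [F] up by one degree,
    and what overflows is a multiple of coefficients already known to vanish;
    so each coefficient of the remainder of [F] shows up as a top coefficient. *)
Lemma sym_rem_coef0 i : \pi ((sym_rem k F)`_i) = 0.
Proof.
have [ki|ik] := leqP k i.
  by rewrite nth_default ?apr0 // (leq_trans (size_sym_rem _ _)).
suff H j : (j <= k)%N -> forall i, (k - j <= i)%N -> \pi ((sym_rem k F)`_i) = 0.
  by apply: (H k) => //; rewrite subnn.
elim: j => [_ l|j IHj jk l].
  rewrite subn0 => kl.
  by rewrite nth_default ?apr0 // (leq_trans (size_sym_rem _ _)).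
rewrite leq_eqVlt => /orP[/eqP lE|ltl]; last first.
  by apply: IHj; rewrite ?(ltnW jk) //; lia.
have := top_coef0 (Ordinal jk); rewrite mulrC sym_rem_mul coef_sum apr_sum /=.
have lk : (l < k)%N by lia.
rewrite (bigD1 (Ordinal lk)) //= big1 => [|a]; last first.
  rewrite -val_eqE /= => nal; rewrite coefZ aprM.
  have [la|al] := ltnP l a.
    by rewrite IHj ?mul0r ?(ltnW jk) //; lia.
  have ltal : (a < l)%N by rewrite ltn_neqAle nal.
  rewrite -exprD sym_rem_Xn; last by lia.
  by rewrite coefXn gtn_eqF ?apr0 ?mulr0 //; lia.
rewrite addr0 coefZ -exprD sym_rem_Xn; last by lia.
have -> : k.-1 = (j + l)%N by lia.
by rewrite coefXn eqxx mulr1.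
Qed.

Lemma sym_rem_mul_coef0 u i : \pi ((sym_rem k (u * F))`_i) = 0.
Proof.
rewrite sym_rem_mul coef_sum apr_sum big1 // => l _.
by rewrite coefZ aprM sym_rem_coef0 mul0r.
Qed.

Definition congr_mod (u v : {poly K}) := exists g, u = v + g * F.

(** The two expansions along row [i0] have coefficients that agree in the
    quotient. *)
Lemma bialternant_congr_row (f g : 'I_k -> {poly K}) i0 :
  congr_mod (f i0) (g i0) -> (forall i, i != i0 -> f i = g i) ->
  \pi (bialternant f) = \pi (bialternant g).
Proof.
case=> u fg0 fg; rewrite (bialternant_row f i0) (bialternant_row g i0) !apr_sum.
apply: eq_bigr => l _; rewrite !aprM fg0 sym_remD coefD aprD sym_rem_mul_coef0.
rewrite addr0; congr (_ * \pi (bialternant _)); apply/funext => i.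
by case: eqP => // /eqP /fg.
Qed.

(** Replaces the rows one at a time. *)
Lemma bialternant_congr (f g : 'I_k -> {poly K}) :
  (forall i, congr_mod (f i) (g i)) -> \pi (bialternant f) = \pi (bialternant g).
Proof.
move=> fg; pose h (s : seq 'I_k) i := if i \in s then f i else g i.
have hs s : \pi (bialternant (h s)) = \pi (bialternant g).
  elim: s => [|a s IHs]; first by congr (\pi (bialternant _)).
  rewrite -IHs; apply: (@bialternant_congr_row _ _ a).
    rewrite /h inE eqxx; case: (a \in s) => //=.
    by exists 0; rewrite mul0r addr0.
  by move=> i nia; rewrite /h inE (negbTE nia).
rewrite -(hs (enum 'I_k)); congr (\pi (bialternant _)).
by apply/funext => i; rewrite /h mem_enum.
Qed.

End BialternantReduction.

Section TopCoefficient.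
Variables (K : idomainType) (k : nat) (y : nat -> K).

Definition with_top (u : {poly K}) (i : 'I_k) :=
  if i.+1 == k :> nat then u else factorial_power y i.

Hypothesis k_gt0 : (0 < k)%N.

Let last_lt : (k.-1 < k)%N. Proof. by rewrite prednK. Qed.
Let last : 'I_k := Ordinal last_lt.

Let eq_last (i : 'I_k) : (i == last) = (i.+1 == k).
Proof. by rewrite -val_eqE /= -eqSS prednK. Qed.

(** Expanding along the last row, every power below the top one gives a row in the
    span of the others. *)
Lemma bialternant_with_top u :
  bialternant (with_top u) = (sym_rem k u)`_k.-1.
Proof.
rewrite (bialternant_row _ last) /with_top /= prednK // eqxx.
rewrite (bigD1 last) //= big1 => [|l nl].
  rewrite addr0 [X in _ * X]bialternant_monic ?mulr1 // => i.
    rewrite eq_last; case: eqP => _; first exact: monicXn.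
    exact: monic_factorial_power.
  rewrite eq_last; case: eqP => [e|_]; last exact: size_factorial_power.
  by rewrite size_polyXn prednK.
have ll : (l < k.-1)%N.
  by have := ltn_ord l; move: nl; rewrite eq_last; case: eqP => //; lia.
rewrite [X in _ * X](_ : _ = 0) ?mulr0 //.
(* all rows have degree less than [k.-1], so the last coefficients vanish *)
apply: vdm_inj; rewrite bialternantE sympoly_val0 mul0r alternant_coef.
  rewrite (expand_det_col _ last) big1 ?scale0r ?mul0r // => i _; rewrite mxE.
  rewrite eq_last; case: eqP => e; first by rewrite coefXn gtn_eqF ?mul0r.
  rewrite nth_default ?mul0r // size_factorial_power /=.
  by have := ltn_ord i; lia.
move=> i; rewrite eq_last; case: eqP => e.
  by rewrite size_polyXn (leq_trans ll) // leq_pred.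
by rewrite size_factorial_power.
Qed.

Lemma fschur_row_top r :
  fschur_row k y r = (sym_rem k (factorial_power y (r + k.-1)))`_k.-1.
Proof.
rewrite -bialternant_with_top /fschur_row fschur_bialternant.
congr bialternant; apply/funext => i; rewrite /with_top /=.
have -> : (k - i.+1 == 0)%N = (i.+1 == k).
  by rewrite subn_eq0 eqn_leq ltn_ord.
by case: eqP => // e; congr (factorial_power y (r + _)); rewrite -[in RHS]e.
Qed.

Lemma sym_remZ (c : K) u : sym_rem k (c *: u) = c%:A *: sym_rem k u.
Proof.
rewrite /sym_rem -Pdiv.RingMonic.rmodpZ ?monic_root_poly //; congr Pdiv.Ring.rmodp.
by apply/polyP => i; rewrite !(coef_map, coefZ) /= mulr_algl scalerA.
Qed.

Variables (n : nat) (c : K).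
Hypotheses (le_kn : (k <= n)%N) (y0 : forall l, (n <= l)%N -> y l = 0).

Definition quantum_poly : {poly K} := factorial_power y n - c%:P.

Lemma factorial_power_add j :
  factorial_power y (n + j) = factorial_power y n * 'X^j.
Proof.
elim: j => [|j IHj]; first by rewrite addn0 mulr1.
by rewrite addnS factorial_powerS IHj y0 ?leq_addr // subr0 exprSr mulrA.
Qed.

(** The relations of the quantum cohomology ring are the top coefficients that
    the shifts of the quantum polynomial leave modulo [root_poly]; the constant
    term only reaches the top degree in the last shift. *)
Lemma top_coef_quantum (j : 'I_k) :
  (sym_rem k (quantum_poly * 'X^j))`_k.-1 =
  if j.+1 == k :> nat then fschur_row k y n - c%:A
  else fschur_row k y (n - k + 1 + j).
Proof.
have jk := ltn_ord j.
have -> : quantum_poly * 'X^j = factorial_power y (n + j) + (- c) *: 'X^j.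
  by rewrite factorial_power_add mulrBl mul_polyC scaleNr.
rewrite sym_remD coefD sym_remZ sym_rem_Xn // coefZ coefXn !fschur_row_top.
have -> : (k.-1 == j) = (j.+1 == k) by lia.
case: eqP => jl.
  have -> : (n + k.-1 = n + j)%N by lia.
  by rewrite mulr1 scaleNr.
have -> : (n - k + 1 + j + k.-1 = n + j)%N by lia.
by rewrite mulr0 addr0.
Qed.

End TopCoefficient.

(** * Polynomials acting on tensors *)

Section PolynomialOperators.
Variables (K : comNzRingType) (n k : nat) (X : 'M[K]_n).
Implicit Types (t : tensor_power K n k) (p r : {mpoly K[k]}) (m : 'X_{1..k}).

HB.instance Definition _ m := GRing.isLinear.Build K (tensor_power K n k)
  (tensor_power K n k) *:%R (monomial_op X m) (monomial_op_is_linear X m).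

Lemma monomial_opD m m' t :
  monomial_op X (m + m')%MM t = monomial_op X m (monomial_op X m' t).
Proof.
apply: (tens_lin_eq (f := monomial_op X (m + m')%MM)
  (g := monomial_op X m \o monomial_op X m')) t => v /=.
rewrite !monomial_op_tens; congr tens; apply/funext => i.
by rewrite mnmDE iterD.
Qed.

Lemma poly_op_supp (s : seq 'X_{1..k}) p t : uniq s -> {subset msupp p <= s} ->
  poly_op X p t = \sum_(m <- s) p@_m *: monomial_op X m t.
Proof.
move=> us ps; rewrite (bigID (mem (msupp p))) /= [X in _ = _ + X]big1 ?addr0.
  rewrite -big_filter; apply: perm_big; apply: uniq_perm => //.
    exact: filter_uniq.
  by move=> m; rewrite mem_filter andbC; case: (boolP (m \in s)) => //= ns;
    apply/negbTE; apply: contra ns; exact: ps.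
by move=> m nm; rewrite memN_msupp_eq0 // scale0r.
Qed.

Lemma poly_opD p r t : poly_op X (p + r) t = poly_op X p t + poly_op X r t.
Proof.
pose s := undup (msupp (p + r) ++ msupp p ++ msupp r).
have us : uniq s by exact: undup_uniq.
rewrite !(poly_op_supp _ us) -?big_split /=; first last.
- by move=> m mp; rewrite mem_undup !mem_cat mp.
- by move=> m mp; rewrite mem_undup !mem_cat mp !orbT.
- by move=> m mp; rewrite mem_undup !mem_cat mp !orbT.
by apply: eq_bigr => m _; rewrite mcoeffD scalerDl.
Qed.

Lemma poly_opZ a p t : poly_op X (a *: p) t = a *: poly_op X p t.
Proof.
pose s := undup (msupp (a *: p) ++ msupp p).
have us : uniq s by exact: undup_uniq.
rewrite !(poly_op_supp _ us) ?scaler_sumr; first last.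
- by move=> m mp; rewrite mem_undup mem_cat mp.
- by move=> m mp; rewrite mem_undup mem_cat mp orbT.
by apply: eq_bigr => m _; rewrite mcoeffZ scalerA.
Qed.

Lemma poly_op0 t : poly_op X 0 t = 0.
Proof. by rewrite /poly_op msupp0 big_nil. Qed.

Lemma poly_op_sum I (s : seq I) (P : pred I) (F : I -> {mpoly K[k]}) t :
  poly_op X (\sum_(i <- s | P i) F i) t = \sum_(i <- s | P i) poly_op X (F i) t.
Proof. by elim/big_rec2: _ => [|i y x _ <-]; rewrite ?poly_op0 ?poly_opD. Qed.

Lemma poly_opX m t : poly_op X 'X_[m] t = monomial_op X m t.
Proof. by rewrite /poly_op msuppX big_seq1 mcoeffX eqxx scale1r. Qed.

Lemma poly_opM p r t : poly_op X (p * r) t = poly_op X p (poly_op X r t).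
Proof.
elim/mpolyind: p => [|c m p _ _ IHp]; first by rewrite mul0r !poly_op0.
rewrite mulrDl !poly_opD IHp; congr (_ + _).
rewrite -scalerAl !poly_opZ; congr (_ *: _); rewrite poly_opX => {p IHp}.
elim/mpolyind: r => [|d m' r _ _ IHr].
  by rewrite mulr0 !poly_op0 linear0.
rewrite mulrDr !poly_opD linearD IHr; congr (_ + _).
rewrite -scalerAr !poly_opZ linearZ; congr (_ *: _).
by rewrite -mpolyXD !poly_opX monomial_opD.
Qed.

Lemma poly_op1 t : poly_op X 1 t = t.
Proof.
rewrite -mpolyX0 poly_opX; apply: (tens_lin_eq (f := monomial_op X 0%MM)
  (g := idfun)) t => v /=.
by rewrite monomial_op_tens; congr tens; apply/funext => i; rewrite mnm0E.
Qed.

Lemma sym_opM (p r : sympoly K k) x :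
  sym_op X (p * r) x = sym_op X p (sym_op X r x).
Proof.
have -> : x = ext_pi (repr x) by rewrite [RHS]qpiK.
by rewrite !sym_op_pi sympoly_valM poly_opM.
Qed.

Lemma perm_tens_tens (s : 'S_k) (v : 'I_k -> 'cV[K]_n) :
  perm_tens s (tens v) = tens (v \o (s^-1)%g).
Proof.
apply/ffunP => w; rewrite !ffunE (reindex_inj (@perm_inj _ s^-1)).
by apply: eq_bigr => i _; rewrite ffunE permKV.
Qed.

Variable e : 'cV[K]_n.

(** As [e (x) ... (x) e] is fixed by all permutations of the tensor factors, these
    act on [cyclic_tens p] through the variables of [p]. *)
Definition cyclic_tens p : tensor_power K n k := poly_op X p (tens (fun=> e)).

Lemma perm_cyclic_tens (s : 'S_k) p :
  perm_tens s (cyclic_tens p) = cyclic_tens (msym s p).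
Proof.
rewrite /cyclic_tens; elim/mpolyind: p => [|c m p _ _ IHp].
  by rewrite rmorph0 !poly_op0 linear0.
rewrite msymD msymZ !poly_opD [LHS]linearD /= IHp !poly_opZ.
congr (_ + _); rewrite [LHS]linearZ /=; congr (_ *: _).
rewrite msymX !poly_opX !monomial_op_tens perm_tens_tens; congr tens.
by apply/funext => i /=; rewrite mnmE.
Qed.

Lemma alt_cyclic_tens p : alt (cyclic_tens p) =
  cyclic_tens (\sum_(s : 'S_k) (-1) ^+ s *: msym s p).
Proof.
rewrite /cyclic_tens poly_op_sum; apply: eq_bigr => s _.
by rewrite poly_opZ -[poly_op X (msym s p) _]perm_cyclic_tens.
Qed.

End PolynomialOperators.

Section CyclicVectors.
Variables (K : idomainType) (n' k : nat).
Local Notation n := n'.+1.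
Variables (X : 'M[K]_n) (e : 'cV[K]_n).
Implicit Types (f g : 'I_k -> {poly K}) (u : {poly K}) (v : 'I_k -> 'cV[K]_n).

Definition poly_act u (a : 'cV[K]_n) : 'cV[K]_n := horner_mx X u *m a.

Lemma tens_slotD (v : 'I_k -> 'cV[K]_n) i a b c :
  tens (fun l => if l == i then a else v l) +
  c *: tens (fun l => if l == i then b else v l) =
  tens (fun l => if l == i then a + c *: b else v l).
Proof.
pose R (w : {ffun 'I_k -> 'I_n}) := \prod_(l | l != i) v l (w l) 0.
have slotE x (w : {ffun 'I_k -> 'I_n}) :
    tens (fun l => if l == i then x else v l) w = x (w i) 0 * R w.
  rewrite ffunE (bigD1 i) //= eqxx; congr (_ * _).
  by apply: eq_bigr => l /negbTE->.
apply/ffunP => w; rewrite ffunE tensor_scaleE !slotE !mxE.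
by rewrite mulrDl mulrA.
Qed.

Lemma poly_op_polyX i u v : poly_op X (polyX i u) (tens v) =
  tens (fun l => if l == i then poly_act u (v l) else v l).
Proof.
elim/poly_ind: u v => [|u c IHu] v.
  rewrite rmorph0 poly_op0; apply/ffunP => w; rewrite !ffunE (bigD1 i) //= eqxx.
  by rewrite /poly_act rmorph0 mul0mx mxE mul0r.
rewrite rmorphD rmorphM /= polyX_X polyX_C poly_opD poly_opM poly_opX.
rewrite monomial_op_tens poly_opZ poly_op1 IHu /=.
pose v' l := if l == i then poly_act u (X *m v i) else v l.
have -> : tens (fun l => if l == i then poly_act u (iter (U_(i)%MM l) (mulmx X) (v l))
    else iter (U_(i)%MM l) (mulmx X) (v l)) =
    tens (fun l => if l == i then poly_act u (X *m v i) else v l).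
  congr tens; apply/funext => l; rewrite mnm1E eq_sym.
  by case: eqP => [->|].
have -> : tens v = tens (fun l => if l == i then v i else v l).
  by congr tens; apply/funext => l; case: eqP => [->|].
rewrite tens_slotD; congr tens; apply/funext => l; case: eqP => // ->.
rewrite /poly_act rmorphD rmorphM /= horner_mx_X horner_mx_C mulmxDl.
by rewrite -mulmxA mul_scalar_mx.
Qed.

(** Each variable acts on its own tensor factor. *)
Lemma poly_op_prod f v : poly_op X (\prod_i polyX i (f i)) (tens v) =
  tens (fun i => poly_act (f i) (v i)).
Proof.
have -> : tens (fun i => poly_act (f i) (v i)) =
    tens (fun i => if i \in index_enum 'I_k then poly_act (f i) (v i) else v i).
  by congr tens; apply/funext => i; rewrite mem_index_enum.
elim: (index_enum _) (index_enum_uniq 'I_k) => [_|i s IHs /= /andP[nis us]].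
  by rewrite big_nil poly_op1.
rewrite big_cons poly_opM IHs // poly_op_polyX; congr tens; apply/funext => l.
by rewrite inE; case: eqP => [->|//]; rewrite (negbTE nis).
Qed.

Lemma cyclic_tens_prod f : cyclic_tens X e (\prod_i polyX i (f i)) =
  tens (fun i => poly_act (f i) e).
Proof. exact: poly_op_prod. Qed.

Lemma alt_tens_poly_act f :
  alt (tens (fun i => poly_act (f i) e)) = cyclic_tens X e (alternant f).
Proof.
rewrite -cyclic_tens_prod alt_cyclic_tens alternantE; congr cyclic_tens.
apply: eq_bigr => s _; rewrite rmorph_prod /= mulr_sign -scaler_sign.
by congr (_ *: _); apply: eq_bigr => i _; rewrite msym_polyX.
Qed.

(** Antisymmetrising turns both sides into the action on the symmetric tensor
    [e (x) ... (x) e] of the same polynomial, since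
    [bialternant f * vdm = alternant f]. *)
Lemma alt_bialternant_op f g :
  (forall i, g i \is monic) -> (forall i, size (g i) = i.+1) ->
  alt (poly_op X (bialternant f) (tens (fun i => poly_act (g i) e))) =
  alt (tens (fun i => poly_act (f i) e)).
Proof.
move=> mg sg; rewrite -cyclic_tens_prod /cyclic_tens -poly_opM.
rewrite -/(cyclic_tens X e _) alt_cyclic_tens alt_tens_poly_act; congr cyclic_tens.
rewrite -bialternantE -(alternant_monic mg sg) alternantE mulr_sumr.
apply: eq_bigr => s _; rewrite msymM rmorph_prod /= mulr_sign -scaler_sign.
have /issymP/(_ s) -> := sympolyP (bialternant f).
rewrite -scalerAr; congr (_ *: (_ * _)).
by apply: eq_bigr => i _; rewrite msym_polyX.
Qed.

End CyclicVectors.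

(** * The exterior power as a quotient of symmetric polynomials *)

Section QuantumIsomorphism.
Variables (K : idomainType) (n' k : nat).
Local Notation n := n'.+1.
Hypotheses (k_gt0 : (0 < k)%N) (le_kn : (k <= n)%N).
Variables (y : nat -> K) (c : K) (X : 'M[K]_n) (gens : sympoly K k -> Prop).
Hypothesis y0 : forall l, (n <= l)%N -> y l = 0.
Hypothesis gensP : forall g, gens g <->
  (exists r : nat, (n - k + 1 <= r <= n - 1)%N /\ g = fschur_row k y r) \/
  g = fschur_row k y n - c%:A.

Local Notation e0 := (delta_mx ord0 0 : 'cV[K]_n).
Local Notation F := (quantum_poly y n c).
Hypothesis poly_act_basis : forall a : 'I_n,
  poly_act X (factorial_power y a) e0 = delta_mx a 0.
Hypothesis poly_act_quantum : poly_act X F e0 = 0.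

Local Notation E := (ext_power K n k).
Local Notation Q := (quot_alg gens).
Local Notation "\pi x" := (apr gens x) (at level 10, x at level 8).
Implicit Types (u : {poly K}) (a b : 'cV[K]_n) (v : 'I_k -> 'cV[K]_n).

Lemma poly_actD u1 u2 a :
  poly_act X (u1 + u2) a = poly_act X u1 a + poly_act X u2 a.
Proof. by rewrite /poly_act rmorphD mulmxDl. Qed.

Lemma poly_actZ d u a : poly_act X (d *: u) a = d *: poly_act X u a.
Proof.
by rewrite -mul_polyC /poly_act rmorphM /= horner_mx_C -mulmxA mul_scalar_mx.
Qed.

Lemma poly_actM u1 u2 a : poly_act X (u1 * u2) a = poly_act X u1 (poly_act X u2 a).
Proof. by rewrite /poly_act rmorphM mulmxA. Qed.

Lemma poly_act_sum (I : finType) (G : I -> {poly K}) a :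
  poly_act X (\sum_i G i) a = \sum_i poly_act X (G i) a.
Proof.
apply: (big_morph (fun u => poly_act X u a)) => [u1 u2|]; first exact: poly_actD.
by rewrite /poly_act rmorph0 mul0mx.
Qed.

Lemma poly_actXn m a : poly_act X 'X^m a = iter m (mulmx X) a.
Proof.
elim: m => [|m IHm]; first by rewrite /poly_act rmorph1 mul1mx.
by rewrite exprS poly_actM IHm /poly_act horner_mx_X.
Qed.

Lemma gens_top (j : 'I_k) : \pi ((sym_rem k (F * 'X^j))`_k.-1) = 0.
Proof.
rewrite top_coef_quantum //; apply/apr_gen/gensP; case: eqP => jk.
  by right.
by left; exists (n - k + 1 + j)%N; split=> //; have := ltn_ord j; lia.
Qed.

(** [F] annihilates [e0], and no nonzero polynomial of smaller degree does: its
    expansion in factorial powers is read off from the coordinates of the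
    vector that it makes out of [e0]. *)
Lemma congr_mod_poly_act u1 u2 :
  poly_act X u1 e0 = poly_act X u2 e0 -> congr_mod F u1 u2.
Proof.
have sF : size F = n.+1.
  rewrite size_polyDl size_factorial_power // size_polyN.
  by rewrite (leq_ltn_trans (size_polyC_leq1 _)).
have mF : F \is monic.
  have /monicP := monic_factorial_power y n.
  rewrite lead_coefE size_factorial_power monicE lead_coefE sF coefB => ->.
  by rewrite coefC subr0.
move=> e12; pose d := u1 - u2; exists (Pdiv.Ring.rdivp d F).
apply/eqP; rewrite addrC -subr_eq -/d; apply/eqP.
rewrite {1}(Pdiv.RingMonic.rdivp_eq mF d); set r := Pdiv.Ring.rmodp _ _.
have [|g rE] := @newton_expand K y n r.
  by rewrite -ltnS -sF Pdiv.Ring.ltn_rmodpN0 // monic_neq0.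
suff g0 i : g i = 0.
  by rewrite rE big1 ?addr0 // => i _; rewrite g0 scale0r.
have : poly_act X r e0 = 0.
  have <- : poly_act X d e0 = 0.
    by rewrite /d -scaleN1r poly_actD poly_actZ e12 scaleN1r subrr.
  rewrite [in RHS](Pdiv.RingMonic.rdivp_eq mF d) poly_actD poly_actM poly_act_quantum.
  by rewrite [X in _ = X + _]mulmx0 add0r.
rewrite rE poly_act_sum => /colP/(_ i); rewrite summxE mxE.
rewrite (bigD1 i) //= poly_actZ poly_act_basis !mxE !eqxx mulr1 big1 ?addr0 // => j nj.
by rewrite poly_actZ poly_act_basis !mxE eq_sym (negbTE nj) mulr0.
Qed.

(** The preimage of smallest degree under the identification of the module with the
    polynomials modulo [F]. *)
Definition poly_of a : {poly K} := \sum_i a i 0 *: factorial_power y i.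

Lemma poly_act_poly_of a : poly_act X (poly_of a) e0 = a.
Proof.
rewrite poly_act_sum; apply/colP => i; rewrite summxE (bigD1 i) //=.
rewrite poly_actZ poly_act_basis.
rewrite !mxE !eqxx mulr1 big1 ?addr0 // => j nj.
by rewrite poly_actZ poly_act_basis !mxE eq_sym (negbTE nj) mulr0.
Qed.

Lemma poly_of_delta i : poly_of (delta_mx i 0) = factorial_power y i.
Proof.
rewrite /poly_of (bigD1 i) //= mxE !eqxx scale1r big1 ?addr0 // => j nj.
by rewrite mxE (negbTE nj) scale0r.
Qed.

(** ** From the exterior power to the quotient *)

(** Replaces a wedge product by a bialternant, see [ext_to_quot_wedge]. *)
Definition tensor_to_quot (t : tensor_power K n k) : Q :=
  \sum_(w : {ffun 'I_k -> 'I_n})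
    t w *: \pi (bialternant (fun i => factorial_power y (w i))).

Fact tensor_to_quot_is_linear : linear tensor_to_quot.
Proof.
move=> d t t'; rewrite scaler_sumr -big_split; apply: eq_bigr => w _ /=.
by rewrite !ffunE scalerDl scalerA.
Qed.
HB.instance Definition _ := GRing.isLinear.Build K (tensor_power K n k) Q
  *:%R tensor_to_quot tensor_to_quot_is_linear.

Lemma tensor_to_quot_tens v :
  tensor_to_quot (tens v) = \pi (bialternant (fun i => poly_of (v i))).
Proof.
rewrite (bialternant_expand (fun i (j : 'I_n) => v i j 0)
  (fun j => factorial_power y j)).
by rewrite apr_sum; apply: eq_bigr => w _; rewrite ffunE aprZ.
Qed.

Lemma tensor_to_quot_relator t : alternating_relator t -> tensor_to_quot t = 0.
Proof.
case=> v [[i [j [nij vij]]] ->]; rewrite tensor_to_quot_tens.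
by rewrite (bialternant_alternating nij) ?apr0 // vij.
Qed.

Definition ext_to_quot (x : E) : Q := tensor_to_quot (repr x).

Lemma ext_to_quot_pi t : ext_to_quot (ext_pi t) = tensor_to_quot t.
Proof. exact: (linear_repr_qpi tensor_to_quot_relator). Qed.

Lemma ext_to_quot_wedge v :
  ext_to_quot (wedge v) = \pi (bialternant (fun i => poly_of (v i))).
Proof. by rewrite ext_to_quot_pi tensor_to_quot_tens. Qed.

Fact ext_to_quot_is_linear : linear ext_to_quot.
Proof.
move=> d x z; have piK (u : E) : ext_pi (repr u) = u by exact: qpiK.
by rewrite -[x]piK -[z]piK -linearP !ext_to_quot_pi linearP.
Qed.
HB.instance Definition _ := GRing.isLinear.Build K E Q *:%R ext_to_quot
  ext_to_quot_is_linear.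

(** ** From the quotient to the exterior power *)

(** A representative of the ket of the identity permutation. *)
Definition id_tens : tensor_power K n k :=
  tens (fun i => poly_act X (factorial_power y i) e0).

Definition sym_to_ext (p : sympoly K k) : E := sym_op X p (ext_pi id_tens).

Lemma sym_to_extE p : sym_to_ext p = ext_pi (poly_op X p id_tens).
Proof. exact: sym_op_pi. Qed.

Fact sym_to_ext_is_linear : linear sym_to_ext.
Proof.
move=> d p r; rewrite !sym_to_extE -linearP; congr ext_pi.
by rewrite -poly_opZ -poly_opD -sympoly_valZ -[in RHS]rmorphD.
Qed.
HB.instance Definition _ := GRing.isLinear.Build K (sympoly K k) E *:%R
  sym_to_ext sym_to_ext_is_linear.

(** By [alt_inj] it is enough to compare antisymmetrised tensors. *)
Lemma sym_to_ext_bialternant (f : 'I_k -> {poly K}) :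
  sym_to_ext (bialternant f) = wedge (fun i => poly_act X (f i) e0).
Proof.
rewrite sym_to_extE; apply: (alt_inj le_kn); apply: alt_bialternant_op => i.
  exact: monic_factorial_power.
exact: size_factorial_power.
Qed.

(** Each generator is a bialternant one of whose rows is a multiple of [F], which
    annihilates [e0]. *)
Lemma sym_to_ext_gen g : gens g -> sym_to_ext g = 0.
Proof.
have top0 (j : 'I_k) : sym_to_ext ((sym_rem k (F * 'X^j))`_k.-1) = 0.
  rewrite -(bialternant_with_top y) // sym_to_ext_bialternant.
  have lt_last : (k.-1 < k)%N by rewrite prednK.
  apply: ext_pi_eq0; rewrite [tens _](_ : _ = 0) ?span0 //.
  apply/ffunP => w; rewrite !ffunE (bigD1 (Ordinal lt_last)) //=.
  rewrite /with_top /= prednK // eqxx mulrC [F * _]mulrC poly_actM poly_act_quantum.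
  by rewrite /poly_act mulmx0 mxE mulr0.
case/gensP => [[r [/andP[ler rle] ->]]|->].
  have jk : (r - (n - k + 1) < k)%N by lia.
  have := top0 (Ordinal jk); rewrite top_coef_quantum //= ifN_eq; last by lia.
  by rewrite subnKC.
have jk : (k.-1 < k)%N by rewrite prednK.
have := top0 (Ordinal jk).
by rewrite top_coef_quantum //= prednK // eqxx.
Qed.

Lemma sym_to_ext_multiple_of_gen x : multiple_of_gen gens x -> sym_to_ext x = 0.
Proof.
case=> p [g [gg ->]]; rewrite /sym_to_ext sym_opM -/(sym_to_ext g) sym_to_ext_gen //.
have -> : (0 : E) = ext_pi 0 by exact/esym/(linear0 (@ext_pi K n k)).
by rewrite sym_op_pi linear0.
Qed.

Definition quot_to_ext (x : Q) : E := sym_to_ext (repr x).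

Lemma quot_to_ext_pi p : quot_to_ext (\pi p) = sym_to_ext p.
Proof. exact: (linear_repr_qpi sym_to_ext_multiple_of_gen). Qed.

Fact quot_to_ext_is_linear : linear quot_to_ext.
Proof.
move=> d x z; rewrite -[x]aprK -[z]aprK -aprZ -aprD !quot_to_ext_pi; exact: linearP.
Qed.
HB.instance Definition _ := GRing.isLinear.Build K Q E *:%R quot_to_ext
  quot_to_ext_is_linear.

(** On wedge products, [sym_to_ext_bialternant] undoes [ext_to_quot_wedge]. *)
Lemma ext_to_quotK : cancel ext_to_quot quot_to_ext.
Proof.
move=> x; have -> : x = ext_pi (repr x) by rewrite [RHS]qpiK.
rewrite ext_to_quot_pi; apply: (tens_lin_eq (f := quot_to_ext \o tensor_to_quot)
  (g := @ext_pi K n k)) => v /=.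
rewrite tensor_to_quot_tens quot_to_ext_pi sym_to_ext_bialternant.
congr (ext_pi (tens _)).
by apply/funext => i; rewrite poly_act_poly_of.
Qed.

(** [p] sends the basis wedge to a combination, over its monomials, of wedges of
    multiples of the factorial powers; up to multiples of [F], the images of
    these are the terms by which [sym_mul_bialternant] expands the product of [p]
    with the bialternant of the factorial powers, which is 1. *)
Lemma quot_to_extK : cancel quot_to_ext ext_to_quot.
Proof.
move=> x; rewrite -[x]aprK; move: (repr x) => p.
rewrite quot_to_ext_pi sym_to_extE ext_to_quot_pi /poly_op linear_sum.
under eq_bigr => m _ do rewrite linearZ /= monomial_op_tens tensor_to_quot_tens -aprZ.
transitivity (\pi (p * bialternant (fun i : 'I_k => factorial_power y i))).
  rewrite sym_mul_bialternant apr_sum; apply: eq_bigr => m _; rewrite !aprZ.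
  congr (_ *: _); apply: (bialternant_congr gens_top) => i.
  by apply: congr_mod_poly_act; rewrite poly_act_poly_of poly_actM poly_actXn.
rewrite bialternant_monic ?mulr1 // => i; first exact: monic_factorial_power.
exact: size_factorial_power.
Qed.

Lemma quot_to_extM p x : quot_to_ext (\pi p * x) = sym_op X p (quot_to_ext x).
Proof. by rewrite -[x]aprK -aprM !quot_to_ext_pi /sym_to_ext sym_opM. Qed.

Lemma ext_to_quot_ket (w : grass n k) :
  ext_to_quot (ket_wedge K le_kn w) = \pi (fschur y (grass_part le_kn w)).
Proof.
rewrite ext_to_quot_wedge fschur_bialternant; congr (\pi (bialternant _)).
apply/funext => i; rewrite poly_of_delta /grass_part rev_ordK subnK //.
exact: letter_ge.
Qed.

Lemma ext_to_quot1 : ext_to_quot (ket_wedge K le_kn (grass1 n k)) = 1.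
Proof.
rewrite ext_to_quot_wedge [bialternant _](_ : _ = 1) // bialternant_monic // => i.
  by rewrite poly_of_delta letter1 monic_factorial_power.
by rewrite poly_of_delta letter1 size_factorial_power.
Qed.

(** ** The product *)

Local Notation ket1 := (ket_wedge K le_kn (grass1 n k)).

Definition quantum_star (x z : E) : E := quot_to_ext (ext_to_quot x * ext_to_quot z).

Lemma ext_to_quotM : {morph ext_to_quot : x z / quantum_star x z >-> x * z}.
Proof. by move=> x z; rewrite /quantum_star quot_to_extK. Qed.

Lemma quantum_starC : commutative quantum_star.
Proof. by move=> x z; rewrite /quantum_star mulrC. Qed.

Lemma quantum_starA : associative quantum_star.
Proof. by move=> x z t; rewrite /quantum_star !quot_to_extK mulrA. Qed.

Lemma quantum_star1x : left_id ket1 quantum_star.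
Proof. by move=> x; rewrite /quantum_star ext_to_quot1 mul1r ext_to_quotK. Qed.

Lemma quantum_starx1 : right_id ket1 quantum_star.
Proof. by move=> x; rewrite quantum_starC quantum_star1x. Qed.

Fact quantum_star_linear_r x : linear (quantum_star x).
Proof.
move=> a z z'; rewrite /quantum_star (ext_to_quot_is_linear a z z') mulrDr.
rewrite [X in quot_to_ext (X + _)]mulrC -quot_scaleAl quot_to_ext_is_linear.
by rewrite [ext_to_quot z * _]mulrC.
Qed.

Fact quantum_star_linear_l z : linear (quantum_star^~ z).
Proof.
by move=> a x x'; rewrite /= ![quantum_star _ z]quantum_starC quantum_star_linear_r.
Qed.

Lemma quantum_star_ket w z :
  quantum_star (ket_wedge K le_kn w) z = sym_op X (fschur y (grass_part le_kn w)) z.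
Proof. by rewrite /quantum_star ext_to_quot_ket quot_to_extM ext_to_quotK. Qed.

End QuantumIsomorphism.

Lemma bilinear_ket_expand (K : comNzRingType) n k (lekn : (k <= n)%N)
    (f : ext_power K n k -> ext_power K n k -> ext_power K n k) :
  (forall x, linear (f x)) -> (forall z, linear (f^~ z)) -> forall x z,
  f x z = \sum_w \sum_u (ext_coord lekn w x * ext_coord lekn u z) *:
            f (ket_wedge K lekn w) (ket_wedge K lekn u).
Proof.
have lin (h : ext_power K n k -> ext_power K n k) : linear h -> forall x,
    h x = \sum_w ext_coord lekn w x *: h (ket_wedge K lekn w).
  move=> lh x.
  pose H : {linear ext_power K n k -> ext_power K n k} :=
    HB.pack h (GRing.isLinear.Build _ _ _ _ h lh).
  rewrite {1}(ext_expand lekn x) -[h]/(H : _ -> _) linear_sum.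
  by apply: eq_bigr => w _; rewrite linearZ.
move=> fr fl x z; rewrite (lin _ (fl z)); apply: eq_bigr => w _.
rewrite (lin _ (fr _)) scaler_sumr; apply: eq_bigr => u _.
by rewrite scalerA.
Qed.

(** * The grading of the ground ring *)

Section HomogeneousPolynomials.
Variable n : nat.
Implicit Types (p r : {poly ybase n}) (d e : int).

(** Contrapositive to the shape in the definition of [qbase_homog], which suits
    coefficients of sums and products better. *)
Definition poly_homog d p := forall i (m : 'X_{1..n}),
  (mdeg m + n * i)%:Z <> d -> (p`_i : {mpoly int[n]})@_m = 0.

Lemma poly_homogP d p : poly_homog d p <->
  (forall i (m : 'X_{1..n}), m \in msupp (p`_i : {mpoly int[n]}) ->
     (mdeg m + n * i)%:Z = d).
Proof.
split=> hp i m.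
  rewrite mcoeff_msupp => nz; apply/eqP; apply: contraNT nz => /eqP ne.
  by rewrite hp.
move=> ne; apply/eqP; rewrite mcoeff_eq0; apply/negP => /hp; exact: ne.
Qed.

Lemma poly_homog0 d : poly_homog d 0.
Proof. by move=> i m _; rewrite coef0 mcoeff0. Qed.

Lemma poly_homogB d p r :
  poly_homog d p -> poly_homog d r -> poly_homog d (p - r).
Proof. by move=> hp hr i m ne; rewrite coefB mcoeffB hp // hr // subr0. Qed.

Lemma poly_homogM d e p r :
  poly_homog d p -> poly_homog e r -> poly_homog (d + e) (p * r).
Proof.
move=> hp hr i m ne; rewrite coefM raddf_sum big1 // => j _ /=.
rewrite mcoeffM big1 // => -[m1 m2] /= /eqP me.
have [d1|/eqP nd1] := eqVneq (mdeg m1 + n * j)%:Z d; last by rewrite hp ?mul0r.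
rewrite [X in _ * X]hr ?mulr0 // => d2; apply: ne.
rewrite me mdegD -d1 -d2 -[in LHS](subnKC (_ : j <= i)%N) -1?ltnS //.
by rewrite mulnDr; lia.
Qed.

Lemma poly_homogC d (c : ybase n) :
  (forall m, (mdeg m)%:Z <> d -> (c : {mpoly int[n]})@_m = 0) -> poly_homog d c%:P.
Proof.
move=> hc i m; rewrite coefC; case: eqP => [->|_ _]; last by rewrite mcoeff0.
by rewrite muln0 addn0; exact: hc.
Qed.

Lemma poly_homogXn N : poly_homog (n * N)%:Z 'X^N.
Proof.
move=> i m; rewrite coefXn; case: eqP => [->|_ _]; last by rewrite mcoeff0.
rewrite mcoeff1; case: eqP => // -> []; by rewrite mdeg0.
Qed.

Lemma poly_homog_monomial (c : int) (m : 'X_{1..n}) i :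
  poly_homog (mdeg m + n * i)%:Z
    (((c *: 'X_[m] : {mpoly int[n]}) : ybase n)%:P * 'X^i).
Proof.
rewrite PoszD; apply: poly_homogM; last exact: poly_homogXn.
apply: poly_homogC => m' ne.
rewrite mcoeffZ mcoeffX; case: eqP => [e|]; last by rewrite mulr0.
by case: ne; rewrite e.
Qed.

End HomogeneousPolynomials.

Section HomogeneousScalars.
Variable n : nat.
Local Notation K := (qbase n).
Implicit Types (f g : K) (d e : int).
Local Notation Xf := (tofrac ('X : {poly ybase n})).

Let X_neq0 N : Xf ^+ N != 0.
Proof. by rewrite expf_neq0 // tofrac_eq0 polyX_eq0. Qed.

Lemma qbase_homogP d f : qbase_homog d f <-> exists N p,
  laurent_val f * Xf ^+ N = tofrac p /\ poly_homog (d + (n * N)%:Z) p.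
Proof.
by split=> -[N [p [fE hp]]]; exists N, p; split=> //; apply/poly_homogP.
Qed.

(** Numerators over any larger power of the quantum parameter. *)
Lemma qbase_homog_raise d f : qbase_homog d f -> exists N0, forall N,
  (N0 <= N)%N -> exists p,
    laurent_val f * Xf ^+ N = tofrac p /\ poly_homog (d + (n * N)%:Z) p.
Proof.
move/qbase_homogP=> [N0 [p [fE hp]]]; exists N0 => N leN.
exists (p * 'X^(N - N0)); rewrite tofracM tofracXn -fE -mulrA -exprD subnKC //.
split=> //; have -> : d + (n * N)%:Z = d + (n * N0)%:Z + (n * (N - N0))%:Z.
  by rewrite -addrA -PoszD -mulnDr subnKC.
apply: poly_homogM hp _; exact: poly_homogXn.
Qed.

Lemma qbase_homog_poly d (p : {poly ybase n}) :
  poly_homog d p -> qbase_homog d (poly_laurent p : K).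
Proof.
move=> hp; apply/qbase_homogP; exists 0%N, p; rewrite expr0 mulr1; split=> //.
by rewrite muln0 addr0.
Qed.

Lemma qbase_homog0 d : qbase_homog d (0 : K).
Proof.
apply/qbase_homogP; exists 0%N, 0; rewrite [laurent_val _](rmorph0 val) mul0r.
by split; [rewrite tofrac0|exact: poly_homog0].
Qed.

Lemma qbase_homog1 : qbase_homog 0 (1 : K).
Proof.
apply/qbase_homogP; exists 0%N, 1; rewrite [laurent_val _](rmorph1 val) mul1r.
rewrite tofrac1 expr0 muln0 addr0; split=> //.
by have := @poly_homogXn n 0; rewrite muln0.
Qed.

Lemma qbase_homogB d f g :
  qbase_homog d f -> qbase_homog d g -> qbase_homog d (f - g).
Proof.
move=> /qbase_homog_raise[N fN] /qbase_homog_raise[M gM].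
have [p [fE hp]] := fN (N + M)%N (leq_addr _ _).
have [r [gE hr]] := gM (N + M)%N (leq_addl _ _).
apply/qbase_homogP; exists (N + M)%N, (p - r).
rewrite [laurent_val _](rmorphB val) mulrBl tofracB.
by split; [congr (_ - _)|exact: poly_homogB].
Qed.

Lemma qbase_homogM d e f g :
  qbase_homog d f -> qbase_homog e g -> qbase_homog (d + e) (f * g).
Proof.
move=> /qbase_homogP[N [p [fE hp]]] /qbase_homogP[M [r [gE hr]]].
apply/qbase_homogP; exists (N + M)%N, (p * r).
rewrite [laurent_val _](rmorphM val) exprD mulrACA tofracM.
split; first by congr (_ * _).
have -> : d + e + (n * (N + M))%:Z = (d + (n * N)%:Z) + (e + (n * M)%:Z).
  by rewrite mulnDr PoszD addrACA.
exact: poly_homogM.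
Qed.

Lemma qbase_homogN d f : qbase_homog d f -> qbase_homog d (- f).
Proof. by rewrite -sub0r; apply: qbase_homogB; exact: qbase_homog0. Qed.

Lemma qbase_homogD d f g :
  qbase_homog d f -> qbase_homog d g -> qbase_homog d (f + g).
Proof. by rewrite -[g in f + g]opprK => hf /qbase_homogN; exact: qbase_homogB. Qed.

Lemma qbase_homog_sum d I (r : seq I) (P : pred I) (f : I -> K) :
  (forall i, P i -> qbase_homog d (f i)) ->
  qbase_homog d (\sum_(i <- r | P i) f i).
Proof.
move=> hf; elim/big_ind: _ => //; first exact: qbase_homog0.
by move=> *; exact: qbase_homogD.
Qed.

Lemma qbase_homog_sign d f (b : bool) :
  qbase_homog d f -> qbase_homog d ((-1) ^+ b * f).
Proof.
by move=> hf; rewrite mulr_sign; case: ifP => // _; exact: qbase_homogN.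
Qed.

Lemma qbase_homog_qvar : qbase_homog n%:Z (qvar n).
Proof.
by apply: qbase_homog_poly; have := @poly_homogXn n 1; rewrite muln1 expr1.
Qed.

Lemma qbase_homog_yvar l : qbase_homog 1 (yvar n l).
Proof.
apply: qbase_homog_poly; apply: poly_homogC => m; case: insub => [i|_].
  by rewrite mcoeffX; case: eqP => // <- []; rewrite mdeg1.
by rewrite mcoeff0.
Qed.

(** Homogeneous elements of different degrees are linearly independent: over a
    common power of [q] they have numerators of different degrees. *)
Lemma qbase_homog_free (s : seq int) (f : int -> K) : uniq s ->
  (forall d, d \in s -> qbase_homog d (f d)) -> \sum_(d <- s) f d = 0 ->
  forall d, d \in s -> f d = 0.
Proof.
move=> us hf f0 d0 d0s.
have /choice[N0 NE] d : exists N0, forall N, (N0 <= N)%N -> d \in s -> exists p,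
    laurent_val (f d) * Xf ^+ N = tofrac p /\ poly_homog (d + (n * N)%:Z) p.
  case: (boolP (d \in s)) => [/hf/qbase_homog_raise[N1 H]|]; last by exists 0%N.
  by exists N1 => N /H.
pose N := (\sum_(d <- s) N0 d)%N.
have /choice[p pE] d : exists p, d \in s ->
    laurent_val (f d) * Xf ^+ N = tofrac p /\ poly_homog (d + (n * N)%:Z) p.
  case: (boolP (d \in s)) => [ds|]; last by exists 0.
  have [|p] := NE d N _ ds; last by exists p.
  by rewrite /N (bigD1_seq d) //= leq_addr.
have sp0 : \sum_(d <- s) p d = 0.
  apply/eqP; rewrite -tofrac_eq0 rmorph_sum /=; apply/eqP.
  rewrite big_seq; under eq_bigr => d ds do rewrite -(pE d ds).1.
  rewrite -big_seq -mulr_suml.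
  have -> : \sum_(d <- s) laurent_val (f d) = 0.
    by rewrite -(rmorph_sum (val : K -> _)) f0 rmorph0.
  by rewrite mul0r.
have p0 : p d0 = 0.
  apply/polyP => i; apply/mpolyP => m; rewrite coef0 mcoeff0.
  have [e|/eqP ne] := eqVneq (mdeg m + n * i)%:Z (d0 + (n * N)%:Z); last first.
    exact: (pE d0 d0s).2.
  have := congr1 (fun p : {poly ybase n} => (p`_i : {mpoly int[n]})@_m) sp0.
  rewrite coef_sum raddf_sum (bigD1_seq d0) //= coef0 mcoeff0.
  rewrite big_seq_cond big1 ?addr0 // => d /andP[ds nd].
  by apply: (pE d ds).2; rewrite e => /addIr ed; rewrite ed eqxx in nd.
apply/val_inj/(mulIf (X_neq0 N)); rewrite [LHS](pE d0 d0s).1 p0 tofrac0.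
by rewrite [val 0](rmorph0 val) mul0r.
Qed.

End HomogeneousScalars.

(** ** Decomposition into homogeneous components *)

Section HomogeneousDecomposition.
Variables (A : zmodType) (piece : int -> A -> Prop).
Hypotheses (piece0 : forall d, piece d 0)
  (pieceD : forall d x z, piece d x -> piece d z -> piece d (x + z)).

Definition decomposable x := exists (s : seq int) (f : int -> A),
  [/\ uniq s, forall d, piece d (f d) & x = \sum_(d <- s) f d].

Lemma decomposable0 : decomposable 0.
Proof. by exists [::], (fun=> 0); rewrite big_nil. Qed.

Lemma decomposable_add_piece d x z :
  decomposable x -> piece d z -> decomposable (x + z).
Proof.
case=> s [f [us pf ->]] pz; pose f' e := if e == d then f e + z else f e.
have pf' e : piece e (f' e).
  by rewrite /f'; case: eqP => // ->; apply: pieceD.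
have [ds|nds] := boolP (d \in s).
  exists s, f'; split=> //; rewrite !(bigD1_seq d) //= /f' eqxx addrAC.
  by congr (_ + _); apply: eq_bigr => e /negbTE->.
exists (d :: s), (fun e => if e == d then z else f e); split.
- by rewrite /= nds.
- by move=> e; case: eqP => // ->.
rewrite big_cons eqxx addrC; congr (_ + _); rewrite !big_seq.
by apply: eq_bigr => e es; case: eqP => // ed; rewrite -ed es in nds.
Qed.

Lemma decomposable_sum I (r : seq I) (P : pred I) (deg : I -> int) (x : I -> A) :
  (forall i, P i -> piece (deg i) (x i)) ->
  decomposable (\sum_(i <- r | P i) x i).
Proof.
move=> px; elim/big_rec: _ => [|i z Pi Dz]; first exact: decomposable0.
by rewrite addrC; apply: decomposable_add_piece (px i Pi).
Qed.

Lemma decomposableD x z : decomposable x -> decomposable z -> decomposable (x + z).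
Proof.
move=> Dx [s [f [_ pf ->]]]; elim: s => [|d s IHs]; first by rewrite big_nil addr0.
by rewrite big_cons [f d + _]addrC addrA; apply: decomposable_add_piece (pf d).
Qed.

End HomogeneousDecomposition.

Section LaurentInverse.
Variable D : idomainType.
Implicit Types (p : {poly D}) (f : laurent D).
Local Notation Xf := (tofrac ('X : {poly D})).

Lemma tofracX_neq0 N : Xf ^+ N != 0.
Proof. by rewrite expf_neq0 // tofrac_eq0 polyX_eq0. Qed.

Fact is_laurent_invXn N : is_laurent (Xf ^- N).
Proof. by apply/asboolP; exists N, 1; rewrite mulVf ?tofrac1 ?tofracX_neq0. Qed.

Definition laurent_invXn N : laurent D := MkLaurent (is_laurent_invXn N).

Lemma laurent_invXnE N : laurent_val (laurent_invXn N) * Xf ^+ N = tofrac 1.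
Proof. by rewrite mulVf ?tofrac1 ?tofracX_neq0. Qed.

Lemma laurent_fractionE f N p : laurent_val f * Xf ^+ N = tofrac p ->
  f = poly_laurent p * laurent_invXn N.
Proof.
move=> fE; apply/val_inj/(mulIf (tofracX_neq0 N)).
by rewrite [LHS]fE rmorphM /= mulfVK ?tofracX_neq0.
Qed.

Lemma poly_laurent_sum I (r : seq I) (P : pred I) (F : I -> {poly D}) :
  poly_laurent (\sum_(i <- r | P i) F i) = \sum_(i <- r | P i) poly_laurent (F i).
Proof. by apply: val_inj; rewrite rmorph_sum /= rmorph_sum. Qed.

End LaurentInverse.

Lemma poly_mpoly_expand n (p : {poly ybase n}) :
  p = \sum_(i < size p) \sum_(m <- msupp (p`_i : {mpoly int[n]}))
    (((p`_i : {mpoly int[n]})@_m *: 'X_[m] : {mpoly int[n]}) : ybase n)%:P * 'X^i.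
Proof.
rewrite -{1}[p]coefK poly_def; apply: eq_bigr => i _.
by rewrite -mulr_suml -rmorph_sum -mpolyE mul_polyC.
Qed.

(** The monomials of a numerator, divided by the power of [q]. *)
Lemma qbase_decomposable n (f : qbase n) : decomposable (@qbase_homog n) f.
Proof.
have /asboolP[N [p fE]] := valP f.
pose qinv : qbase n := laurent_invXn (ybase n) N.
have qinv_homog : qbase_homog (- (n * N)%:Z) qinv.
  apply/qbase_homogP; exists N, 1; split; first exact: laurent_invXnE.
  by rewrite addNr; have := @poly_homogXn n 0; rewrite muln0.
rewrite (laurent_fractionE fE) -/qinv (poly_mpoly_expand p) poly_laurent_sum.
rewrite mulr_suml; elim/big_ind: _ => [||i _].
- by apply: decomposable0; exact: qbase_homog0.
- by move=> *; apply: decomposableD => // *; exact: qbase_homogD.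
rewrite poly_laurent_sum mulr_suml.
apply: (@decomposable_sum _ _ _ _ _ _ _
  (fun m : 'X_{1..n} => (mdeg m + n * i)%:Z - (n * N)%:Z)).
- exact: qbase_homog0.
- by move=> *; exact: qbase_homogD.
move=> m _; apply: qbase_homogM qinv_homog; apply: qbase_homog_poly.
exact: poly_homog_monomial.
Qed.

(** * Homogeneity of factorial Schur polynomials *)

Lemma sum_ord_ltn k i : (\sum_(j < k | i < j) 1 = k - i.+1)%N.
Proof.
rewrite big_mkcond; elim: k => [|k IHk]; first by rewrite big_ord0.
rewrite big_ord_recr /= IHk; by case: (ltnP i k) => h; lia.
Qed.

Section HomogeneousMpolys.
Variables n k : nat.
Local Notation K := (qbase n).
Implicit Types (p r : {mpoly K[k]}) (d e : int) (m : 'X_{1..k}).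

Definition mpoly_homog d p := forall m, qbase_homog (d - (mdeg m)%:Z) p@_m.

Lemma mpoly_homogB d p r :
  mpoly_homog d p -> mpoly_homog d r -> mpoly_homog d (p - r).
Proof. by move=> hp hr m; rewrite mcoeffB; apply: qbase_homogB. Qed.

Lemma mpoly_homog0 d : mpoly_homog d 0.
Proof. by move=> m; rewrite mcoeff0; exact: qbase_homog0. Qed.

Lemma mpoly_homogN d p : mpoly_homog d p -> mpoly_homog d (- p).
Proof. by rewrite -sub0r; apply: mpoly_homogB; exact: mpoly_homog0. Qed.

Lemma mpoly_homogD d p r :
  mpoly_homog d p -> mpoly_homog d r -> mpoly_homog d (p + r).
Proof. by rewrite -[r in p + r]opprK => hp /mpoly_homogN; exact: mpoly_homogB. Qed.

Lemma mpoly_homog_sum d I (s : seq I) (P : pred I) (F : I -> {mpoly K[k]}) :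
  (forall i, P i -> mpoly_homog d (F i)) ->
  mpoly_homog d (\sum_(i <- s | P i) F i).
Proof.
move=> hF; elim/big_ind: _ => //; first exact: mpoly_homog0.
by move=> *; exact: mpoly_homogD.
Qed.

Lemma mpoly_homogM d e p r :
  mpoly_homog d p -> mpoly_homog e r -> mpoly_homog (d + e) (p * r).
Proof.
move=> hp hr m; rewrite mcoeffM; apply: qbase_homog_sum => -[m1 m2] /= /eqP me.
have -> : d + e - (mdeg m)%:Z = d - (mdeg m1)%:Z + (e - (mdeg m2)%:Z).
  by have := congr1 mdeg me; rewrite mdegD; lia.
exact: qbase_homogM.
Qed.

Lemma mpoly_homog1 : mpoly_homog 0 1.
Proof.
move=> m; rewrite mcoeff1; case: eqP => [->|_]; last exact: qbase_homog0.
by rewrite mdeg0 subr0; exact: qbase_homog1.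
Qed.

Lemma mpoly_homogX i : mpoly_homog 1 'X_i.
Proof.
move=> m; rewrite mcoeffX; case: eqP => [<-|_]; last exact: qbase_homog0.
by rewrite mdeg1 subrr; exact: qbase_homog1.
Qed.

Lemma mpoly_homogC d (c : K) : qbase_homog d c -> mpoly_homog d c%:A.
Proof.
move=> hc m; rewrite mcoeffZ mcoeff1; case: eqP => [->|_].
  by rewrite mulr1 mdeg0 subr0.
by rewrite mulr0; exact: qbase_homog0.
Qed.

Lemma mpoly_homog_prod I (s : seq I) (P : pred I) (deg : I -> nat)
    (F : I -> {mpoly K[k]}) : (forall i, mpoly_homog (deg i)%:Z (F i)) ->
  mpoly_homog (\sum_(i <- s | P i) deg i)%N%:Z (\prod_(i <- s | P i) F i).
Proof.
move=> hF; elim/big_rec2: _ => [|i x y _ hy]; first exact: mpoly_homog1.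
by rewrite PoszD; apply: mpoly_homogM.
Qed.

Lemma fact_power_homog (j : 'I_k) (l : nat) :
  mpoly_homog l%:Z (fact_power (yvar n) ('X_j : {mpoly K[k]}) l).
Proof.
rewrite -[l in l%:Z]card_ord -sum1_card; apply: mpoly_homog_prod => a.
by apply: mpoly_homogB; [exact: mpoly_homogX|apply/mpoly_homogC/qbase_homog_yvar].
Qed.

Lemma fschur_num_homog (lam : 'I_k -> nat) :
  mpoly_homog (\sum_i (lam i + (k - i.+1)))%N%:Z (fschur_num (yvar n) lam).
Proof.
apply: mpoly_homog_sum => s _; rewrite mulr_sign.
have h : mpoly_homog (\sum_i (lam i + (k - i.+1)))%N%:Z (\prod_i
    (\matrix_(i < k, j < k) fact_power (yvar n) ('X_j : {mpoly K[k]})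
       (lam i + (k - i.+1))) i (s i)).
  by apply: mpoly_homog_prod => i; rewrite mxE; exact: fact_power_homog.
by case: ifP => _ //; exact: mpoly_homogN.
Qed.

(** Factors that may be cancelled from a homogeneous product without knowing
    beforehand that the cofactor is homogeneous. *)
Definition homog_cancel (e : nat) r := forall d p,
  mpoly_homog (d + e%:Z) (p * r) -> mpoly_homog d p.

Lemma mcoeffMXi p (i : 'I_k) m :
  (p * 'X_i)@_m = if (m i == 0)%N then 0 else p@_(m - U_(i)).
Proof.
case: eqP => [mi|/eqP mi].
  rewrite mcoeffM big1 // => -[m1 m2] /= /eqP me.
  rewrite mcoeffX; case: eqP => [e|]; last by rewrite mulr0.
  have := congr1 (fun m : 'X_{1..k} => m i) me.
  by rewrite -e mnmDE mnm1E eqxx mi addn1.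
rewrite -{1}(@submK _ U_(i) m) ?mcoeffMX //; last first.
  by apply/mnm_lepP => l; rewrite mnm1E; case: eqP => // <-; rewrite lt0n.
by rewrite addmC mcoeffMX.
Qed.

(** The coefficient of [p] at [m] is that of [p * ('X_i - 'X_j)] at [m + U_(i)]
    plus that of [p] at [m + U_(i) - U_(j)], whose exponent of ['X_j] is smaller. *)
Lemma homog_cancel_subX (i j : 'I_k) : i != j -> homog_cancel 1 ('X_i - 'X_j).
Proof.
move=> nij d p hp m; move: {2}(m j) (leqnn (m j)) => N.
elim: N m => [|N IHN] m mN; have := hp (m + U_(i))%MM;
  rewrite mulrBr mcoeffB !mcoeffMXi !mnmDE !mnm1E eqxx addn1 /= addmK
    (negbTE nij) addn0 mdegD mdeg1 PoszD opprD addrACA subrr addr0.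
  by move: mN; rewrite leqn0 => /eqP ->; rewrite subr0.
case: eqP => [_|/eqP mj]; first by rewrite subr0.
set m' := (_ - _)%MM => h.
have mU : (U_(j) + m')%MM = (m + U_(i))%MM.
  rewrite addmC submK //; apply/mnm_lepP => l; rewrite mnm1E.
  by case: eqP => // <-; rewrite mnmDE lt0n addn_eq0 negb_and mj.
have dm' : mdeg m' = mdeg m.
  by have := congr1 mdeg mU; rewrite !mdegD !mdeg1; lia.
have /IHN hm' : (m' j <= N)%N.
  by have := congr1 (fun m : 'X_{1..k} => m j) mU; rewrite !mnmDE !mnm1E eqxx
    (negbTE nij); lia.
by rewrite -[p@_m](subrK p@_m'); apply: qbase_homogD => //; rewrite -dm'.
Qed.

Lemma homog_cancel_prod I (s : seq I) (P : pred I) (e : I -> nat)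
    (F : I -> {mpoly K[k]}) : (forall i, P i -> homog_cancel (e i) (F i)) ->
  homog_cancel (\sum_(i <- s | P i) e i) (\prod_(i <- s | P i) F i).
Proof.
move=> hF; elim/big_rec2: _ => [|i x y Pi hy] d p; first by rewrite addr0 mulr1.
by rewrite mulrA PoszD addrA => h; apply: (hF i Pi); exact: hy.
Qed.

(** Numerator and denominator are visibly homogeneous, and the factors of the
    denominator can be cancelled one by one. *)
Lemma fschur_homog (lam : 'I_k -> nat) :
  mpoly_homog (\sum_i lam i)%N%:Z (fschur (yvar n) lam : {mpoly K[k]}).
Proof.
have hden : homog_cancel (\sum_(i < k) (k - i.+1)) (fschur_den K k).
  apply: homog_cancel_prod => i _; rewrite -sum_ord_ltn.
  apply: homog_cancel_prod => j ltij; apply: homog_cancel_subX.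
  by apply: contraTneq ltij => ->; rewrite ltnn.
apply: hden; rewrite [X in mpoly_homog _ X]fschurE -PoszD -big_split.
exact: fschur_num_homog.
Qed.

End HomogeneousMpolys.

(** * Degrees in the exterior power *)

Section HomogeneousTensors.
Variables n k : nat.
Local Notation K := (qbase n).
Hypothesis lekn : (k <= n)%N.
Implicit Types (t : tensor_power K n k) (d e : int) (w u : grass n k).

(** [Xq] raises degrees by one: its entry [(a, j)] makes up for the difference
    between the degrees of the basis vectors [j] and [a]. *)
Lemma Xq_homog (a j : 'I_n) : qbase_homog (1 + j%:Z - a%:Z) (Xq n k a j).
Proof.
rewrite mxE; apply: qbase_homogD; first apply: qbase_homogD.
- case: andP => [[/eqP a0 /eqP jn]|_]; last exact: qbase_homog0.
  have -> : 1 + j%:Z - a%:Z = 0 + n%:Z by rewrite a0; lia.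
  apply: qbase_homogM; last exact: qbase_homog_qvar.
  rewrite -signr_odd -[X in qbase_homog _ X]mulr1.
  by apply: qbase_homog_sign; exact: qbase_homog1.
- case: eqP => [->|_]; last exact: qbase_homog0.
  have -> : 1 + j%:Z - j.+1%:Z = 0 by lia.
  exact: qbase_homog1.
- case: eqP => [->|_]; last exact: qbase_homog0.
  by rewrite addrK; exact: qbase_homog_yvar.
Qed.

(** Normalised so that the basis tensor of a word has degree the sum of its letters,
    counted from 0; the letters of the identity word shift this with respect to
    the sizes of partitions, see [letter_sum_size]. *)
Definition tensor_homog d t := forall w : {ffun 'I_k -> 'I_n},
  qbase_homog (d - (\sum_i (w i : nat))%N%:Z) (t w).

Lemma tensor_homog0 d : tensor_homog d 0.
Proof. by move=> w; rewrite ffunE; exact: qbase_homog0. Qed.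

Lemma tensor_homogD d t t' :
  tensor_homog d t -> tensor_homog d t' -> tensor_homog d (t + t').
Proof. by move=> ht ht' w; rewrite ffunE; apply: qbase_homogD. Qed.

Lemma tensor_homogZ d e (c : K) t :
  qbase_homog e c -> tensor_homog d t -> tensor_homog (e + d) (c *: t).
Proof. by move=> hc ht w; rewrite tensor_scaleE -addrA; apply: qbase_homogM. Qed.

Lemma factor_op_homog i d t :
  tensor_homog d t -> tensor_homog (d + 1) (factor_op (Xq n k) i t).
Proof.
move=> ht w; rewrite ffunE; apply: qbase_homog_sum => j _.
have -> : d + 1 - (\sum_l (w l : nat))%N%:Z = (1 + j%:Z - (w i)%:Z) +
    (d - (\sum_l (subst_letter w i j l : nat))%N%:Z).
  rewrite (bigD1 i) //= [X in _ - X%:Z = _]addnC.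
  rewrite [in RHS](bigD1 i) //= ffunE eqxx.
  under [in RHS]eq_bigr => l nl do rewrite ffunE (negbTE nl).
  lia.
exact: qbase_homogM (Xq_homog _ _) (ht _).
Qed.

Lemma iter_factor_op_homog i N d t :
  tensor_homog d t -> tensor_homog (d + N%:Z) (iter N (factor_op (Xq n k) i) t).
Proof.
move=> ht; elim: N => [|N IHN]; first by rewrite addr0.
by rewrite -addn1 PoszD addrA addn1; exact: factor_op_homog.
Qed.

Lemma monomial_op_homog (m : 'X_{1..k}) d t :
  tensor_homog d t -> tensor_homog (d + (mdeg m)%:Z) (monomial_op (Xq n k) m t).
Proof.
move=> ht; rewrite mdegE -big_enum /= /monomial_op.
elim: (enum _) => [|i s IHs]; first by rewrite big_nil addr0.
rewrite big_cons /= addnC PoszD addrA; exact: iter_factor_op_homog.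
Qed.

Lemma poly_op_homog (p : {mpoly K[k]}) d e t :
  mpoly_homog e p -> tensor_homog d t ->
  tensor_homog (e + d) (poly_op (Xq n k) p t).
Proof.
move=> hp ht; rewrite /poly_op; elim/big_ind: _ => [||m _].
- exact: tensor_homog0.
- by move=> *; exact: tensor_homogD.
have -> : e + d = (e - (mdeg m)%:Z) + (d + (mdeg m)%:Z) by lia.
apply: tensor_homogZ; first exact: hp.
exact: monomial_op_homog.
Qed.

Definition letter_sum w := (\sum_i (letter lekn w i : nat))%N.

Lemma letter_sum_size w : letter_sum w = (grass_size lekn w + \sum_(i < k) i)%N.
Proof.
rewrite /grass_size (reindex_inj rev_ord_inj) -big_split.
by apply: eq_bigr => i _; rewrite /grass_part rev_ordK /= subnK // letter_ge.
Qed.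

Lemma ext_coord_homog w d t : tensor_homog d t ->
  qbase_homog (d - (letter_sum w)%:Z) (ext_coord lekn w (ext_pi t)).
Proof.
move=> ht; rewrite ext_coord_pi altE; apply: qbase_homog_sum => s _.
apply: qbase_homog_sign.
have -> : letter_sum w =
    (\sum_i ([ffun i => grass_word lekn w (s i)] i : nat))%N.
  rewrite /letter_sum (reindex_inj (@perm_inj _ s)).
  by apply: eq_bigr => i _; rewrite !ffunE.
exact: ht.
Qed.

Let coordB w (x z : exterior n k) :
  ext_coord lekn w (x - z) = ext_coord lekn w x - ext_coord lekn w z.
Proof. exact: (ext_coordB lekn w x z). Qed.

Let coordD w (x z : exterior n k) :
  ext_coord lekn w (x + z) = ext_coord lekn w x + ext_coord lekn w z.
Proof. exact: (ext_coordD lekn w x z). Qed.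

Let coordZ w c (x : exterior n k) :
  ext_coord lekn w (c *: x) = c * ext_coord lekn w x.
Proof. exact: (ext_coordZ lekn w c x). Qed.

Lemma exterior_homogP d (x : exterior n k) : exterior_homog lekn d x <->
  forall w, qbase_homog (d - (grass_size lekn w)%:Z) (ext_coord lekn w x).
Proof.
split=> [[c [hc ->]] w|hx]; last first.
  exists (fun w => ext_coord lekn w x).
  by split; [exact: hx|exact: (ext_expand lekn x)].
have -> : ext_coord lekn w (\sum_u c u *: ket lekn u) = c w.
  exact: ext_coord_sum_ket.
exact: hc.
Qed.

Lemma exterior_homog0 d : exterior_homog lekn d 0.
Proof.
apply/exterior_homogP => w.
by rewrite [ext_coord _ _ _]ext_coord0; exact: qbase_homog0. Qed.

Lemma exterior_homogB d x z : exterior_homog lekn d x ->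
  exterior_homog lekn d z -> exterior_homog lekn d (x - z).
Proof.
move=> /exterior_homogP hx /exterior_homogP hz; apply/exterior_homogP => w.
rewrite coordB.
exact: (qbase_homogB (hx w) (hz w)).
Qed.

Lemma exterior_homogD d x z : exterior_homog lekn d x ->
  exterior_homog lekn d z -> exterior_homog lekn d (x + z).
Proof.
move=> /exterior_homogP hx /exterior_homogP hz; apply/exterior_homogP => w.
rewrite coordD.
exact: (qbase_homogD (hx w) (hz w)).
Qed.

Lemma exterior_homogZ d e (c : K) x : qbase_homog e c ->
  exterior_homog lekn d x -> exterior_homog lekn (e + d) (c *: x).
Proof.
move=> hc /exterior_homogP hx; apply/exterior_homogP => w.
by rewrite coordZ -addrA; apply: qbase_homogM.
Qed.

Lemma exterior_homog_sum d I (s : seq I) (P : pred I) (x : I -> exterior n k) :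
  (forall i, P i -> exterior_homog lekn d (x i)) ->
  exterior_homog lekn d (\sum_(i <- s | P i) x i).
Proof.
move=> hx; elim/big_ind: _ => //; first exact: exterior_homog0.
by move=> *; exact: exterior_homogD.
Qed.

Lemma ket_homog w : exterior_homog lekn (grass_size lekn w)%:Z (ket lekn w).
Proof.
apply/exterior_homogP => u; rewrite [ext_coord _ _ _]ext_coord_ket.
case: eqP => [->|_].
  by rewrite subrr; exact: qbase_homog1.
exact: qbase_homog0.
Qed.

Lemma grass_size1 : grass_size lekn (grass1 n k) = 0%N.
Proof.
rewrite /grass_size big1 // => i _.
by rewrite /grass_part letter1 subnn.
Qed.

Lemma exterior_decomposable (x : exterior n k) :
  decomposable (exterior_homog lekn) x.
Proof.
have D0 := decomposable0 (exterior_homog0 : forall d, exterior_homog lekn d 0).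
rewrite (ext_expand lekn x); elim/big_ind: _ => [||w _] //.
  by move=> *; apply: decomposableD => //; exact: exterior_homogD.
have [s [f [us hf ->]]] := qbase_decomposable (ext_coord lekn w x).
rewrite scaler_suml; apply: (@decomposable_sum _ _ _ _ _ _ _
  (fun d => d + (grass_size lekn w)%:Z)).
- exact: exterior_homog0.
- exact: exterior_homogD.
by move=> d _; apply: exterior_homogZ (hf d) (ket_homog w).
Qed.

(** Compares coordinates, where the degrees are shifted by the size of the
    ket. *)
Lemma exterior_homog_free (s : seq int) (f : int -> exterior n k) : uniq s ->
  (forall d, exterior_homog lekn d (f d)) -> \sum_(d <- s) f d = 0 ->
  forall d, d \in s -> f d = 0.
Proof.
move=> us hf f0 d ds; apply: (@ext_coord_inj K n k lekn (f d) 0) => w.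
rewrite [RHS](ext_coord0 K lekn w).
pose h e := e + (grass_size lekn w)%:Z; pose h' e := e - (grass_size lekn w)%:Z.
have hK e : h (h' e) = e by rewrite /h /h' subrK.
have := @qbase_homog_free n (map h' s) (fun e => ext_coord lekn w (f (h e))).
rewrite map_inj_uniq; last by move=> a b /addIr.
move=> /(_ us); rewrite big_map => H; rewrite -[d in f d]hK; apply: H.
- by move=> _ /mapP[e es ->]; rewrite hK; have /exterior_homogP := hf e; apply.
- under eq_bigr => e _ do rewrite hK.
  transitivity (ext_coord lekn w (\sum_(e <- s) f e)).
    exact/esym/(ext_coord_sum lekn w s xpredT f).
  by rewrite f0; exact: (ext_coord0 K lekn w).
by apply/mapP; exists d.
Qed.

Lemma schubert_op_homog w u : exterior_homog lekn
  ((grass_size lekn w)%:Z + (grass_size lekn u)%:Z)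
  (Xq_op (schubert lekn w) (ket lekn u)).
Proof.
apply/exterior_homogP => v; rewrite /Xq_op sym_op_pi.
have hu : tensor_homog (letter_sum u)%:Z
    (tens (fun i => delta_mx (letter lekn u i) 0) : tensor_power K n k).
  have -> : (fun i => delta_mx (letter lekn u i) 0) =
      (fun i => delta_mx (grass_word lekn u i) 0) :> ('I_k -> 'cV[K]_n).
    by apply/funext => i; rewrite ffunE.
  move=> a; rewrite [tens _ _]basis_tensE.
  case: eqP => [->|_]; last exact: qbase_homog0.
  rewrite /letter_sum; under [in X in _ - X]eq_bigr => i _ do rewrite ffunE.
  by rewrite subrr; exact: qbase_homog1.
have -> : (grass_size lekn w)%:Z + (grass_size lekn u)%:Z -
    (grass_size lekn v)%:Z = (grass_size lekn w)%:Z + (letter_sum u)%:Z -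
    (letter_sum v)%:Z by rewrite !letter_sum_size; lia.
apply: ext_coord_homog; apply: poly_op_homog hu; exact: fschur_homog.
Qed.

End HomogeneousTensors.

(** * The quantised Chern root *)

Section QuantumChernRoot.
Variables n' k : nat.
Local Notation n := n'.+1.
Local Notation K := (qbase n).
Hypotheses (k_gt0 : (0 < k)%N) (lekn : (k <= n)%N).
Local Notation X := (Xq n k).
Local Notation y := (yvar n).
Local Notation c := ((-1) ^+ (k - 1) * qvar n : K).

Lemma yvar0 l : (n <= l)%N -> y l = 0.
Proof.
move=> nl; rewrite /yvar insubN -?leqNgt // polyC0.
by apply: val_inj; rewrite [LHS]tofrac0 [RHS](rmorph0 val).
Qed.

Lemma qH_relationP g : @qH_relation n k g <->
  (exists r : nat, (n - k + 1 <= r <= n - 1)%N /\ g = fschur_row k y r) \/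
  g = fschur_row k y n - c%:A.
Proof.
suff -> : - (c%:A : sympoly K k) = ((-1) ^+ k * qvar n)%:A by [].
by rewrite -scaleNr -mulNr -mulN1r -exprS subn1 prednK.
Qed.

Lemma Xq_delta (a : 'I_n) (i : 'I_n) : (X *m delta_mx a 0) i (0 : 'I_1) = X i a.
Proof. by rewrite -colE mxE. Qed.

Lemma Xq_shift (a b : 'I_n) : b = a.+1 :> nat ->
  X *m delta_mx a 0 = delta_mx b 0 + y a *: delta_mx a 0 :> 'cV[K]_n.
Proof.
move=> ba; apply/colP => i; rewrite Xq_delta !mxE -ba -!val_eqE /= !andbT.
have -> : (b == n :> nat) = false by have := ltn_ord b; lia.
rewrite andbF mulr0n add0r; congr (_ + _).
by case: eqP => [->|]; rewrite ?mulr1 ?mulr0.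
Qed.

Lemma Xq_wrap : X *m delta_mx ord_max 0 =
  c *: delta_mx ord0 0 + y n' *: delta_mx ord_max 0 :> 'cV[K]_n.
Proof.
apply/colP => i; rewrite Xq_delta !mxE -!val_eqE /= !andbT eqxx andbT.
have -> : (i == n :> nat) = false by have := ltn_ord i; lia.
rewrite addr0; congr (_ + _); first by rewrite mulr_natr.
by case: (i =P n' :> nat) => [->|_]; rewrite ?mulr1 ?mulr0.
Qed.

Local Notation e0 := (delta_mx ord0 0 : 'cV[K]_n).

Lemma poly_act_factorS m : poly_act X (factorial_power y m.+1) e0 =
  X *m poly_act X (factorial_power y m) e0
  - y m *: poly_act X (factorial_power y m) e0.
Proof.
rewrite factorial_powerS mulrC poly_actM /poly_act rmorphB /=.
rewrite horner_mx_X horner_mx_C.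
by rewrite mulmxBl mul_scalar_mx.
Qed.

Lemma poly_act_basis_Xq (a : 'I_n) :
  poly_act X (factorial_power y a) e0 = delta_mx a 0.
Proof.
case: a => a; elim: a => [|a IHa] lta.
  rewrite /factorial_power big_ord0 /poly_act rmorph1 mul1mx.
  by congr (delta_mx _ _); apply: val_inj.
have lta' := ltnW lta; rewrite poly_act_factorS (IHa lta').
by rewrite (@Xq_shift _ (Ordinal lta)) // addrK.
Qed.

(** The factorial powers run through the basis, and one step further [Xq_wrap]
    leads back to the multiple [c] of the first vector. *)
Lemma poly_act_quantum_Xq : poly_act X (quantum_poly y n c) e0 = 0.
Proof.
rewrite /quantum_poly -[c%:P]mulr1 mul_polyC -scaleNr.
rewrite poly_actD poly_actZ poly_act_factorS.
rewrite (poly_act_basis_Xq ord_max) Xq_wrap addrK /poly_act rmorph1 mul1mx.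
by rewrite scaleNr subrr.
Qed.

Let qH_of_exterior : exterior n k -> qH n k := ext_to_quot y (@qH_relation n k).
Let qH_of_exterior_is_linear : linear qH_of_exterior.
Proof. exact: ext_to_quot_is_linear. Qed.
HB.instance Definition _ := GRing.isLinear.Build K (exterior n k) (qH n k) *:%R
  qH_of_exterior qH_of_exterior_is_linear.

(** Stated for a successor, since [horner_mx] evaluates polynomials at matrices of
    such sizes only. *)
Lemma quantum_ring :
  exists star : exterior n k -> exterior n k -> exterior n k,
  [/\ quantum_product lekn star,
      forall star', quantum_product lekn star' -> star' =2 star,
      commutative star,
      associative star
    & exists one : exterior n k,
      [/\ left_id one star,
          right_id one star,
          graded_ring star one (exterior_homog lekn)
        & exists phi : {linear exterior n k -> qH n k},
          [/\ bijective phi,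
              phi one = 1,
              {morph phi : x z / star x z >-> x * z}
            & forall w : grass n k, phi (ket lekn w) = schubert_class lekn w]]].
Proof.
have y0 := yvar0; have gP := qH_relationP.
have aB := poly_act_basis_Xq; have aQ := poly_act_quantum_Xq.
pose st : exterior n k -> exterior n k -> exterior n k :=
  quantum_star y X (@qH_relation n k).
pose one : exterior n k := ket lekn (grass1 n k).
have stE w u : st (ket lekn w) (ket lekn u) = Xq_op (schubert lekn w) (ket lekn u).
  exact: (quantum_star_ket k_gt0 lekn y0 gP aB aQ).
have st_r x : linear (st x) by exact: (quantum_star_linear_r k_gt0 lekn y0 gP aQ).
have st_l z : linear (st^~ z) by exact: (quantum_star_linear_l k_gt0 lekn y0 gP aQ).
exists st; split.
- by split.
- move=> st' [st'_r st'_l st'E].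
  move=> x z; rewrite [LHS](bilinear_ket_expand lekn st'_r st'_l).
  rewrite [RHS](bilinear_ket_expand lekn st_r st_l).
  apply: eq_bigr => w _; apply: eq_bigr => u _.
  by congr (_ *: _); rewrite [LHS]st'E [RHS]stE.
- exact: quantum_starC.
- exact: (quantum_starA k_gt0 lekn y0 gP aB aQ).
exists one; split.
- exact: (quantum_star1x k_gt0 lekn y0 gP aB aQ).
- exact: (quantum_starx1 k_gt0 lekn y0 gP aB aQ).
- split.
  + move=> d; split; first exact: exterior_homog0.
    by move=> x z; exact: exterior_homogB.
  + exact: exterior_decomposable.
  + exact: exterior_homog_free.
  + by have := ket_homog lekn (grass1 n k); rewrite grass_size1.
  + move=> d e x z /exterior_homogP hx /exterior_homogP hz.
    rewrite [st x z](bilinear_ket_expand lekn st_r st_l).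
    apply: exterior_homog_sum => w _; apply: exterior_homog_sum => u _.
    have -> : d + e = (d - (grass_size lekn w)%:Z + (e - (grass_size lekn u)%:Z))
        + ((grass_size lekn w)%:Z + (grass_size lekn u)%:Z) by lia.
    apply: exterior_homogZ; first exact: qbase_homogM.
    by rewrite [st _ _]stE; exact: schubert_op_homog.
exists qH_of_exterior; split.
- exists (quot_to_ext y X (gens := @qH_relation n k)).
    exact: (ext_to_quotK k_gt0 lekn y0 gP aB aQ).
  exact: (quot_to_extK k_gt0 lekn y0 gP aB aQ).
- exact: (ext_to_quot1 lekn y (@qH_relation n k)).
- exact: (ext_to_quotM k_gt0 lekn y0 gP aB aQ).
- exact: (ext_to_quot_ket lekn y (@qH_relation n k)).
Qed.

End QuantumChernRoot.

Theorem proposition1p1 (n k : nat) (hn : (2 <= n)%N) (hk : (1 <= k)%N)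
    (hkn : (k <= n)%N) :
  exists star : exterior n k -> exterior n k -> exterior n k,
  [/\ quantum_product hkn star,
      forall star', quantum_product hkn star' -> star' =2 star,
      commutative star,
      associative star
    & exists one : exterior n k,
      [/\ left_id one star,
          right_id one star,
          graded_ring star one (exterior_homog hkn)
        & exists phi : {linear exterior n k -> qH n k},
          [/\ bijective phi,
              phi one = 1,
              {morph phi : x z / star x z >-> x * z}
            & forall w : grass n k, phi (ket hkn w) = schubert_class hkn w]]].
Proof.
case: n hn hkn => [//|n'] hn' hkn'; exact: (quantum_ring hk hkn').
Qed.
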